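(* Let $d\ge 2$ and $k\ge 1$ be integers and let $Q:\mathbb{Z}^k\to(0,\infty)$ be a strictly positive even function (transfer operator) with $Q(0)=1$. Set $\gamma:=\Vert Q\Vert_{\frac{d+1}{2},\mathbb{Z}^k}$ and $\delta:=\Vert Q\Vert_{d+1,\mathbb{Z}^k\setminus\{0\}}$. If $(\gamma,\delta)\in G_d$, then there exists a family $(\mu_i)_{i\in\mathbb{Z}^k}$ of pairwise distinct tree-automorphism invariant Gibbs measures for the specification associated to $Q$ on the Cayley tree $\Gamma^d$, which are equivalent under joint translation of the local spin spaces (i.e. for all $i,j\in\mathbb{Z}^k$, $\mu_j$ is the image of $\mu_i$ under $(\sigma_x)_{x\in V}\mapsto(\sigma_x+j-i)_{x\in V}$). Moreover, for every $i\in\mathbb{Z}^k$ the single-site marginal of $\mu_i$ at a vertex $0\in V$ satisfies $$\left(\delta\,\frac{1-\delta\,\varepsilon(\gamma,\delta)^d}{1+\gamma\,\varepsilon(\gamma,\delta)^{d-1}}\right)^{d+1}\le\frac{\mu_i(\sigma_0\neq i)}{\mu_i(\sigma_0=i)}\le\left(\delta\,\frac{1+\delta\,\varepsilon(\gamma,\delta)^d}{1-\gamma\,\varepsilon(\gamma,\delta)^{d-1}}\right)^{d+1},$$ where $\varepsilon(\gamma,\delta)$ denotes the smallest positive solution of the equation $\varepsilon=\gamma\varepsilon^d+\delta$.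
   Context: The Cayley tree $\Gamma^d=(V,L)$ of order $d$ is the infinite connected graph without cycles in which every vertex has exactly $d+1$ neighbours; $L$ is its set of unoriented edges. For $\Lambda\subset V$, $\partial\Lambda$ is the set of vertices outside $\Lambda$ at graph distance $1$ from $\Lambda$. The configuration space is $\Omega=(\mathbb{Z}^k)^V$, with coordinate maps $\sigma_x$. For an even function $Q:\mathbb{Z}^k\to(0,\infty)$ the associated Gibbsian specification has, for finite $\Lambda\subset V$, kernels $$\gamma_\Lambda(\sigma_\Lambda=\omega_\Lambda\mid\omega)=Z_\Lambda(\omega_{\partial\Lambda})^{-1}\prod_{\{x,y\}\in L,\ \{x,y\}\cap\Lambda\ne\emptyset}Q(\omega_x-\omega_y),$$ where $Z_\Lambda(\omega_{\partial\Lambda})$ is the normalizing constant (finite whenever $\Vert Q\Vert_{\frac{d+1}{2},\mathbb{Z}^k}<\infty$). A Gibbs measure is a probability measure $\mu$ on $\Omega$ with $\mu\gamma_\Lambda=\mu$ for all finite $\Lambda\subset V$. Norms: $\Vert x\Vert_{p,S}=\big(\sum_{j\in S}|x(j)|^p\big)^{1/p}$ for a countable set $S$. The good set is $$G_d:=\{(\gamma,\delta)\in(1,\infty)\times(0,\infty)\mid\exists\,\varepsilon>0:\ \delta+\gamma\varepsilon^d\le\varepsilon\ \text{ and }\ 2d\gamma\varepsilon^{d-1}+2d\delta\varepsilon^d<1\}.$$ *)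

(* Defs.v *)
From HB Require Import structures.
From mathcomp Require Import all_boot all_order all_algebra.
From mathcomp Require Import finmap.
From mathcomp Require Import all_classical all_reals all_analysis.

Set Implicit Arguments.
Unset Strict Implicit.
Unset Printing Implicit Defensive.

Import Order.TTheory GRing.Theory Num.Theory.

Local Open Scope classical_set_scope.
Local Open Scope ring_scope.

(* Locally finite graphs on V are given by their neighbourhoods: x and y are
   adjacent when y \in nb x. *)
Definition adj (V : choiceType) (nb : V -> {fset V}) : rel V :=
  fun x y => y \in nb x.

Record is_cayley_tree (d : nat) (V : choiceType) (nb : V -> {fset V}) : Prop :=
  IsCayleyTree {
    cayley_sym : symmetric (adj nb);
    cayley_irr : irreflexive (adj nb);
    cayley_infinite : infinite_set [set: V];
    cayley_connected :
      forall x y : V, exists p : seq V, path (adj nb) x p /\ last x p = y;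
    cayley_acyclic :
      forall c : seq V, (2 < size c)%N -> ~ ucycle (adj nb) c;
    cayley_degree : forall x : V, #|` nb x| = d.+1
  }.

Definition is_tree_automorphism (V : choiceType) (nb : V -> {fset V})
    (g : V -> V) : Prop :=
  bijective g /\ forall x y : V, adj nb (g x) (g y) = adj nb x y.

(* The unoriented edges meeting the finite set Lambda; each edge occurs once. *)
Definition edges_meeting (V : choiceType) (nb : V -> {fset V})
    (Lambda : {fset V}) : {fset {fset V}} :=
  [fset [fset x; y]%fset | x in Lambda, y in nb x]%fset.

HB.instance Definition _ := isPointed.Build int 0.

Definition cylinders (V : choiceType) (k : nat) : set (set (V -> 'rV[int]_k)) :=
  [set A | exists (x : V) (B : set 'rV[int]_k), A = [set s | B (s x)]].

(* Configurations with the product sigma-algebra, every spin space 'rV[int]_k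
   carrying the discrete sigma-algebra. *)
Notation conf V k := (g_sigma_algebraType (@cylinders V k)).

Section Specification.
Variables (R : realType) (V : choiceType) (nb : V -> {fset V}) (k : nat).
Variable Q : 'rV[int]_k -> R.

(* Q (s x - s y) for the edge b = {x, y}; since Q is even, the order in which
   the endpoints are enumerated is irrelevant. *)
Definition edge_weight (s : V -> 'rV[int]_k) (b : {fset V}) : R :=
  if enum_fset b is [:: x; y] then Q (s x - s y) else 1.

Lemma edge_weightE (Qeven : forall i, Q (- i) = Q i) (s : V -> 'rV[int]_k)
    (x y : V) : x != y -> edge_weight s [fset x; y]%fset = Q (s x - s y).
Proof.
move=> xy; rewrite /edge_weight.
have : perm_eq (enum_fset [fset x; y]%fset) [:: x; y].
  apply: uniq_perm; rewrite ?fset_uniq//= ?inE ?xy//.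
  by move=> z; rewrite !inE.
case: (enum_fset _) => [|a [|b [|c t]]] ab; try by have := perm_size ab.
have ax : a \in [:: x; y] by rewrite -(perm_mem ab) mem_head.
have := perm_uniq ab; rewrite /= !inE xy andbT => ba.
have bx : b \in [:: x; y] by rewrite -(perm_mem ab) !inE eqxx orbT.
move: ax bx ba; rewrite !inE => /orP[] /eqP -> /orP[] /eqP ->; rewrite ?eqxx//.
by rewrite -Qeven opprB.
Qed.

Definition weight (Lambda : {fset V}) (s : V -> 'rV[int]_k) : R :=
  \prod_(b <- edges_meeting nb Lambda) edge_weight s b.

Definition agree_off (Lambda : {fset V}) (w : V -> 'rV[int]_k) :
    set (V -> 'rV[int]_k) :=
  [set s | forall x, x \notin Lambda -> s x = w x].

Definition partition_function (Lambda : {fset V}) (w : V -> 'rV[int]_k) :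
    \bar R :=
  \esum_(s in agree_off Lambda w) (weight Lambda s)%:E.

(* gamma_Lambda (A | w): the configurations agreeing with w off Lambda are the
   w' = (zeta on Lambda, w elsewhere), zeta in (Z^k)^Lambda. *)
Definition specification (Lambda : {fset V}) (A : set (V -> 'rV[int]_k))
    (w : V -> 'rV[int]_k) : \bar R :=
  (\esum_(s in agree_off Lambda w `&` A) (weight Lambda s)%:E
     / partition_function Lambda w)%E.

Definition is_gibbs (mu : probability (conf V k) R) : Prop :=
  forall (Lambda : {fset V}) (A : set (conf V k)), measurable A ->
    (\int[mu]_w specification Lambda A w = mu A)%E.

End Specification.

Definition tree_shift (V : choiceType) (k : nat) (g : V -> V)
    (s : conf V k) : conf V k := fun x => s (g x).

Definition is_tree_invariant (R : realType) (V : choiceType)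
    (nb : V -> {fset V}) (k : nat) (mu : probability (conf V k) R) : Prop :=
  forall g : V -> V, is_tree_automorphism nb g ->
    forall A : set (conf V k), measurable A ->
      pushforward mu (@tree_shift V k g) A = mu A.

Definition translate (V : choiceType) (k : nat) (a : 'rV[int]_k)
    (s : conf V k) : conf V k := fun x => s x + a.

Definition lpnorm (R : realType) (T : choiceType) (p : R) (S : set T)
    (f : T -> R) : \bar R :=
  poweR (\esum_(j in S) (`|f j| `^ p)%:E) p^-1.

Definition good_set (R : realType) (d : nat) : set (R * R) :=
  [set gd | [/\ 1 < gd.1, 0 < gd.2 & exists eps : R,
     [/\ 0 < eps, gd.2 + gd.1 * eps ^+ d <= eps &
         2 * d%:R * gd.1 * eps ^+ d.-1 + 2 * d%:R * gd.2 * eps ^+ d < 1]]].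

Definition is_smallest_positive_solution (R : realType) (d : nat)
    (gamma delta eps : R) : Prop :=
  [/\ 0 < eps, eps = gamma * eps ^+ d + delta &
      forall e : R, 0 < e -> e = gamma * e ^+ d + delta -> eps <= e].

(* Main.v *)
(* A boundary law for the specification is the same as a fixed point [x] of
     x(i) = (Q(i) + sum_(j != 0) Q(i - j) x(j)^d) / (1 + sum_(j != 0) Q(j) x(j)^d),
   for [i != 0], with [x(0) = 1] (here [x] is the [d]-th root of the boundary law).
   Young's inequality for the exponents (d+1)/2, (d+1)/d, d+1 shows that the right-hand
   side maps the ball of radius [eps] of l^(d+1) into itself as soon as
   [delta + gamma eps^d <= eps], and is a contraction there with constant
   [2 d gamma eps^(d-1) + 2 d delta eps^d].  The fixed point yields a reversible
   tree-indexed Markov chain, whose marginal on a finite subtree [W] is an explicit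
   product over the oriented edges leaving the vertices of [W]; it is manifestly
   invariant under automorphisms, and its weights have the Gibbsian form.  The chain is
   realised on [0, 1) by nested subdivisions into intervals, following an enumeration
   of the vertices all of whose initial segments are subtrees.  Shifting [x] by [i]
   gives [mu_i]; the single-site marginal is proportional to [x(j - i)^(d+1)], so the
   claimed ratio is the (d+1)-th power of the norm of [x] off 0, which the fixed-point
   equation bounds from both sides. *)

From HB Require Import structures.
Require Import Defs.
From mathcomp Require Import all_boot all_order all_algebra.
From mathcomp Require Import finmap.
From mathcomp Require Import all_classical all_reals all_analysis.
From mathcomp Require Import measurable_realfun ring.

Set Implicit Arguments.
Unset Strict Implicit.
Unset Printing Implicit Defensive.

Import Order.TTheory GRing.Theory Num.Theory.
Import numFieldNormedType.Exports.

Local Open Scope classical_set_scope.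
Local Open Scope ring_scope.

(** * Finite bounds on sums, Hölder and Minkowski *)

(** Throughout, [d] is written [p.+2]. The exponent (d+1)/2 of [Q] need not be an integer; the
    square root of [Q] lies in l^(d+1), so after splitting [Q] into two square roots every norm is
    an l^(d+1) norm, and a bound by B is stated as a bound by B^(d+1) for the sum of the (d+1)-th
    powers. Actual roots are taken only where a radius has to be named. Square roots return in the
    marginals for another reason: giving the root of the edge weight to each of the two orientations
    of an inner edge avoids the choice of a root vertex, so the formula sees the tree only through
    its neighbourhoods. The two-sided bound rests on two inequalities for the norm xi of x off 0.
    Reading the self-map estimate at the exact radius xi gives xi <= delta + gamma xi^d; the
    pointwise inequality Q(i) <= D x(i) off 0, where D is the denominator at the fixed point, gives
    delta <= D xi. Then xi <= eps and D <= 1 + delta eps^d make both of them linear in xi. *)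

Section SumBounds.
Context {R : realType}.

(** Finite subsums give only one inequality; the other is the same inequality for the factor [c^-1],
    so [c = 0] is split off. *)
Lemma esumZl (T : choiceType) (c : R) (a : T -> \bar R) : 0 <= c ->
    (forall i, (0 <= a i)%E) ->
  (\esum_(i in setT) (c%:E * a i) = c%:E * \esum_(i in setT) a i)%E.
Proof.
have le (e : R) (b : T -> \bar R) : 0 < e -> (forall i, 0 <= b i)%E ->
    (\esum_(i in setT) (e%:E * b i) <= e%:E * \esum_(i in setT) b i)%E.
  move=> e0 b0; apply: ge_ereal_sup => _ [X [fX _] <-].
  rewrite -ge0_mule_fsumr//; apply: lee_wpmul2l; first exact: ltW.
  by apply: esum_ge; exists X.
rewrite le_eqVlt => /predU1P[<-|c0] a0.
  by rewrite mul0e esum1// => i _; rewrite mul0e.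
apply/eqP; rewrite eq_le le//= -lee_pdivlMl//.
apply: le_trans (le _ _ _ _); last 2 first.
- by rewrite invr_gt0.
- by move=> i; rewrite mule_ge0// lee_fin ltW.
by apply: le_esum => i _; rewrite muleA -EFinM mulVf ?gt_eqF// mul1e.
Qed.

(** A bound in place of a value carries summability with it and passes through monotone estimates
    without side conditions. *)
Definition sum_le (T : choiceType) (f : T -> R) (B : R) : Prop :=
  (\esum_(i in setT) (f i)%:E <= B%:E)%E.

Section SumLe.
Variable T : choiceType.
Implicit Types (f g h : T -> R) (A B C c : R).

Lemma sum_leP f B : (forall i, 0 <= f i) ->
  sum_le f B <-> forall X : {fset T}, \sum_(i <- X) f i <= B.
Proof.
move=> f0; split => [fB X|fB].
  rewrite -lee_fin -sumEFin; apply: le_trans fB; apply: esum_ge.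
  by exists [set` X] => //; rewrite fsbig_finite//= set_fsetK.
apply: ge_ereal_sup => _ [X [fX _] <-]; rewrite fsbig_finite//= sumEFin lee_fin.
exact: fB.
Qed.

Lemma sum_le_term f B : (forall i, 0 <= f i) -> sum_le f B ->
  forall i, f i <= B.
Proof.
by move=> f0 /(sum_leP _ f0) fB i; have := fB [fset i]%fset; rewrite big_seq_fset1.
Qed.

Lemma sum_le_ge0 f B : (forall i, 0 <= f i) -> sum_le f B -> 0 <= B.
Proof. by move=> f0 /(sum_leP _ f0) /(_ fset0); rewrite big_seq_fset0. Qed.

Lemma sum_le_mono f g A B : (forall i, f i <= g i) -> A <= B ->
  sum_le g A -> sum_le f B.
Proof.
move=> fg AB gA; apply: (@le_trans _ _ A%:E); last by rewrite lee_fin.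
by apply: le_trans gA; apply: le_esum => i _; rewrite lee_fin.
Qed.

Lemma sum_leD f g A B : (forall i, 0 <= f i) -> (forall i, 0 <= g i) ->
  sum_le f A -> sum_le g B -> sum_le (fun i => f i + g i) (A + B).
Proof.
move=> f0 g0 fA gB; rewrite /sum_le; under eq_esum do rewrite EFinD.
by rewrite esumD// => [|i _|i _]; rewrite ?lee_fin// EFinD leeD.
Qed.

Lemma sum_leZ c f A : 0 <= c -> (forall i, 0 <= f i) ->
  sum_le f A -> sum_le (fun i => c * f i) (c * A).
Proof.
move=> c0 f0 fA; rewrite /sum_le; under eq_esum do rewrite EFinM.
by rewrite esumZl// EFinM lee_wpmul2l.
Qed.

(** The arithmetic-geometric inequality for [x ^+ p.+2], [y ^+ p.+2] and [p] copies of [z ^+ p.+2];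
    with these powers the exponent cancels and no root appears. *)
Lemma AGM3 (x y z : R) p : 0 <= x -> 0 <= y -> 0 <= z ->
  p.+2%:R * (x * y * z ^+ p) <= x ^+ p.+2 + y ^+ p.+2 + p%:R * z ^+ p.+2.
Proof.
move=> x0 y0 z0.
pose E (i : 'I_p.+2) := (if i == 0 then x else if i == 1 then y else z).
have E0 i : 0 <= E i by rewrite /E; case: ifP => // _; case: ifP.
have := leif_AGM (A := predT) (E := fun i => E i ^+ p.+2)
  (fun i _ => exprn_ge0 _ (E0 i)).
rewrite card_ord => -[+ _].
rewrite prodrXl ler_pXn2r// ?nnegrE ?divr_ge0 ?sumr_ge0 ?prodr_ge0//; last first.
  by move=> i _; rewrite exprn_ge0.
rewrite ler_pdivlMr ?ltr0n// mulrC.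
have -> : \prod_i E i = x * y * z ^+ p.
  rewrite !big_ord_recl /= {1 2}/E /= mulrA; congr (_ * _).
  by under eq_bigr do rewrite /E /=; rewrite prodr_const card_ord.
have -> // : \sum_i E i ^+ p.+2 = x ^+ p.+2 + y ^+ p.+2 + p%:R * z ^+ p.+2.
rewrite !big_ord_recl /= {1 2}/E /= addrA; congr (_ + _).
by under eq_bigr do rewrite /E /=; rewrite sumr_const card_ord mulr_natl.
Qed.

(** Covers radius [0] in the Hölder and Minkowski inequalities, where the functions cannot be
    divided by their norms. *)
Lemma vanish_sum n f : (forall i, 0 <= f i) ->
  sum_le (fun i => f i ^+ n.+1) (0 ^+ n.+1) -> forall i, f i = 0.
Proof.
move=> f0 fS i; have := sum_le_term (fun i => exprn_ge0 _ (f0 i)) fS i.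
rewrite expr0n/= => fi; apply/eqP.
suff : f i ^+ n.+1 == 0 by rewrite expf_eq0.
by rewrite eq_le fi exprn_ge0.
Qed.

Lemma convex_expr (s t a b : R) n : 0 <= s -> 0 <= t -> s + t = 1 ->
  0 <= a -> 0 <= b -> (s * a + t * b) ^+ n <= s * a ^+ n + t * b ^+ n.
Proof.
move=> s0 t0 st a0 b0; elim: n => [|n IHn]; first by rewrite !expr0 !mulr1 st.
rewrite exprS; apply: (@le_trans _ _ ((s * a + t * b) * (s * a ^+ n + t * b ^+ n))).
  by rewrite ler_wpM2l// addr_ge0 ?mulr_ge0.
rewrite -subr_ge0.
(* The defect of the induction step is a product of two differences of equal sign, as in Chebyshev's
   sum inequality. *)
have -> : s * a ^+ n.+1 + t * b ^+ n.+1 -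
    (s * a + t * b) * (s * a ^+ n + t * b ^+ n) =
    s * t * ((a - b) * (a ^+ n - b ^+ n)).
  have -> : s = 1 - t by rewrite -st addrK.
  by rewrite !exprS; ring.
apply: mulr_ge0; first exact: mulr_ge0.
case: (leP b a) => [ba|/ltW ab].
  by rewrite mulr_ge0 ?subr_ge0// lerXn2r.
by rewrite mulr_le0// subr_le0// lerXn2r.
Qed.

(** After division by [A], [B], [C] the three sums are at most [1]; the pointwise bound [AGM3] then
    sums to [1 + 1 + p.+1 = p.+3], which cancels the factor on its left-hand side. *)
Lemma sum_hoelder3 p f g h A B C :
    (forall i, 0 <= f i) -> (forall i, 0 <= g i) -> (forall i, 0 <= h i) ->
    0 <= A -> 0 <= B -> 0 <= C ->
  sum_le (fun i => f i ^+ p.+3) (A ^+ p.+3) ->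
  sum_le (fun i => g i ^+ p.+3) (B ^+ p.+3) ->
  sum_le (fun i => h i ^+ p.+3) (C ^+ p.+3) ->
  sum_le (fun i => f i * g i * h i ^+ p.+1) (A * B * C ^+ p.+1).
Proof.
move=> f0 g0 h0 A0 B0 C0 fA gB hC.
have vanish := @vanish_sum p.+2.
have triv (u : T -> R) D : 0 <= D -> (forall i, u i = 0) -> sum_le u D.
  by move=> D0 u0; rewrite /sum_le esum1 ?lee_fin// => i _; rewrite u0.
have ABC : 0 <= A * B * C ^+ p.+1 by rewrite !mulr_ge0// exprn_ge0.
move: A0; rewrite le_eqVlt => /predU1P[A0|A0].
  by apply: triv => // i; rewrite (vanish f) ?mul0r// A0.
move: B0; rewrite le_eqVlt => /predU1P[B0|B0].
  by apply: triv => // i; rewrite (vanish g) ?mulr0 ?mul0r// B0.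
move: C0; rewrite le_eqVlt => /predU1P[C0|C0].
  by subst C; apply: triv => // i; rewrite (vanish h)// expr0n/= mulr0.
have norm (u : T -> R) D : 0 < D -> (forall i, 0 <= u i) ->
    sum_le (fun i => u i ^+ p.+3) (D ^+ p.+3) ->
    sum_le (fun i => (u i / D) ^+ p.+3) 1.
  move=> D0 u0 /(@sum_leZ (D ^- p.+3)) H.
  apply: sum_le_mono (H _ _) => [i||| i].
  - by rewrite expr_div_n mulrC.
  - by rewrite mulVf// expf_neq0// gt_eqF.
  - by rewrite invr_ge0 exprn_ge0// ltW.
  - by rewrite exprn_ge0.
have := sum_leD _ _ (sum_leD _ _ (norm f A A0 f0 fA) (norm g B B0 g0 gB))
  (@sum_leZ p.+1%:R _ _ _ _ (norm h C C0 h0 hC)).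
have ge0 (u : T -> R) D i : 0 < D -> (forall i, 0 <= u i) -> 0 <= (u i / D) ^+ p.+3.
  by move=> D0 u0; rewrite exprn_ge0// divr_ge0// ltW.
move=> /(_ (fun i => addr_ge0 (ge0 _ _ i A0 f0) (ge0 _ _ i B0 g0))).
move=> /(_ (fun i => mulr_ge0 (ler0n _ _) (ge0 _ _ i C0 h0))).
move=> /(_ (fun i => ge0 _ _ i A0 f0) (fun i => ge0 _ _ i B0 g0) (ler0n _ _)
  (fun i => ge0 _ _ i C0 h0)).
move=> /(@sum_leZ (A * B * C ^+ p.+1 / p.+3%:R)) H.
apply: sum_le_mono (H _ _) => [i||| i].
- rewrite [leRHS]mulrAC ler_pdivlMr ?ltr0n// -ler_pdivrMl; last first.
    by rewrite !mulr_gt0// exprn_gt0.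
  apply: le_trans (AGM3 _ _ _ _); rewrite ?divr_ge0 ?(ltW A0) ?(ltW B0) ?(ltW C0)//.
  rewrite expr_div_n le_eqVlt; apply/predU1P; left; field.
  by rewrite (gt_eqF A0) (gt_eqF B0) expf_neq0// gt_eqF.
- by rewrite mulr1 -(natrD _ 2 p.+1) -mulrA mulVf ?mulr1// pnatr_eq0.
- by rewrite divr_ge0.
- by rewrite !addr_ge0 ?ge0// mulr_ge0// ge0.
Qed.

(* [((a+b)/(A+B))^n] is at most the convex combination of [(a/A)^n], [(b/B)^n]
   with weights proportional to [A] and [B]. *)
Lemma sum_minkowski n f g A B : (forall i, 0 <= f i) -> (forall i, 0 <= g i) ->
    0 <= A -> 0 <= B ->
  sum_le (fun i => f i ^+ n.+1) (A ^+ n.+1) ->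
  sum_le (fun i => g i ^+ n.+1) (B ^+ n.+1) ->
  sum_le (fun i => (f i + g i) ^+ n.+1) ((A + B) ^+ n.+1).
Proof.
move=> f0 g0 A0 B0 fA gB.
move: A0; rewrite le_eqVlt => /predU1P[A0|A0].
  apply: sum_le_mono gB => [i|]; last by rewrite -A0 add0r.
  by rewrite (@vanish_sum n f)// ?add0r// A0.
move: B0; rewrite le_eqVlt => /predU1P[B0|B0].
  apply: sum_le_mono fA => [i|]; last by rewrite -B0 addr0.
  by rewrite (@vanish_sum n g)// ?addr0// B0.
have AB : 0 < A + B by rewrite addr_gt0.
apply: sum_le_mono (sum_leD _ _ (@sum_leZ ((A + B) ^+ n * A ^- n) _ _ _ _ fA)
  (@sum_leZ ((A + B) ^+ n * B ^- n) _ _ _ _ gB)).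
- move=> i.
  have := @convex_expr (A / (A + B)) (B / (A + B)) (f i / A) (g i / B) n.+1.
  have -> : A / (A + B) * (f i / A) + B / (A + B) * (g i / B) = (f i + g i) / (A + B).
    by field; rewrite !gt_eqF.
  move=> /(_ (divr_ge0 (ltW A0) (ltW AB)) (divr_ge0 (ltW B0) (ltW AB))).
  rewrite -mulrDl mulfV ?gt_eqF// => /(_ erefl (divr_ge0 (f0 i) (ltW A0))).
  move=> /(_ (divr_ge0 (g0 i) (ltW B0))).
  rewrite [in X in X <= _]expr_div_n ler_pdivrMr ?exprn_gt0//; move/le_trans; apply.
  rewrite le_eqVlt; apply/predU1P; left.
  by rewrite !expr_div_n !exprS; field; rewrite !gt_eqF ?exprn_gt0.
- rewrite le_eqVlt; apply/predU1P; left.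
  by rewrite !exprS; field; rewrite !gt_eqF ?exprn_gt0.
- by move=> i; rewrite mulr_ge0 ?exprn_ge0// mulr_ge0 ?invr_ge0 ?exprn_ge0// ltW.
- by move=> i; rewrite mulr_ge0 ?exprn_ge0// mulr_ge0 ?invr_ge0 ?exprn_ge0// ltW.
- by rewrite mulr_ge0 ?invr_ge0 ?exprn_ge0// ltW.
- by move=> i; rewrite exprn_ge0.
- by rewrite mulr_ge0 ?invr_ge0 ?exprn_ge0// ltW.
- by move=> i; rewrite exprn_ge0.
Qed.
End SumLe.
End SumBounds.

(** * Real sums and Young's inequality *)

Section RealSum.
Context {R : realType}.

(** [fine] sends an infinite sum to [0], so the value is meaningful only together with
    [rsummable]. *)
Definition rsum (T : choiceType) (f : T -> R) : R :=
  fine (\esum_(i in setT) (f i)%:E)%E.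

Definition rsummable (T : choiceType) (f : T -> R) := exists B, sum_le f B.

Section RSum.
Variable T : choiceType.
Implicit Types (f g : T -> R).

Lemma sum_le_rsummable f B : sum_le f B -> rsummable f.
Proof. by exists B. Qed.

Lemma EFin_rsum f : (forall i, 0 <= f i) -> rsummable f ->
  (rsum f)%:E = (\esum_(i in setT) (f i)%:E)%E.
Proof.
move=> f0 [B fB]; rewrite fineK// ge0_fin_numE ?esum_ge0//.
  exact: le_lt_trans fB (ltry _).
by move=> i _; rewrite lee_fin.
Qed.

Lemma rsum_ge0 f : (forall i, 0 <= f i) -> 0 <= rsum f.
Proof. by move=> f0; rewrite fine_ge0// esum_ge0// => i _; rewrite lee_fin. Qed.

Lemma sum_le_rsum f : (forall i, 0 <= f i) -> rsummable f -> sum_le f (rsum f).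
Proof. by move=> f0 fs; rewrite /sum_le EFin_rsum. Qed.

Lemma rsum_le f B : (forall i, 0 <= f i) -> sum_le f B -> rsum f <= B.
Proof. by move=> f0 fB; rewrite -lee_fin EFin_rsum//; exists B. Qed.

Lemma rsum_dist f g C : (forall i, 0 <= f i) -> (forall i, 0 <= g i) ->
    rsummable f -> rsummable g -> sum_le (fun i => `|f i - g i|) C ->
  `|rsum f - rsum g| <= C.
Proof.
have le (f' g' : T -> R) : (forall i, 0 <= f' i) -> (forall i, 0 <= g' i) ->
    rsummable g' -> sum_le (fun i => `|f' i - g' i|) C -> rsum f' <= rsum g' + C.
  move=> f0 g0 sg fg; apply: rsum_le => //.
  apply: sum_le_mono (sum_leD _ _ (sum_le_rsum g0 sg) fg) => // i.
  by rewrite -lerBlDl ler_norm.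
move=> f0 g0 sf sg fg; rewrite ler_distlC; apply/andP; split.
  by rewrite lerBlDr; apply: le.
by apply: le => //; apply: sum_le_mono fg => // i; rewrite distrC.
Qed.
End RSum.

Lemma nth_root_exists n (a : R) : 0 <= a -> exists2 b, 0 <= b & b ^+ n.+1 = a.
Proof.
move=> a0; exists (a `^ n.+1%:R^-1); first exact: powR_ge0.
by rewrite -powR_mulrn ?powR_ge0// -powRrM mulVf// powRr1.
Qed.

Section Convolution.
Variable S : zmodType.
Implicit Types (a b : S -> R).

Lemma sum_le_reflect a A i : (forall i, 0 <= a i) -> sum_le a A ->
  sum_le (fun j => a (i - j)) A.
Proof.
move=> a0 aA; rewrite /sum_le.
rewrite -(reindex_esum setT setT (fun j => i - j) (fun j => (a j)%:E)) //.
split => //= [x y _ _ /addrI/oppr_inj//|y _].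
by exists (i - y) => //; rewrite opprB addrC subrK.
Qed.

Lemma sum_le_shift a A i : (forall i, 0 <= a i) -> sum_le a A ->
  sum_le (fun j => a (j - i)) A.
Proof.
move=> a0 aA; rewrite /sum_le.
rewrite -(reindex_esum setT setT (fun j => j - i) (fun j => (a j)%:E)) //.
split => //= [x y _ _ /addIr//|y _].
by exists (y + i) => //; rewrite addrK.
Qed.

(** By [sum_leP] only finitely many [i] are summed, so the exchange of sums is elementary; for fixed
    [j] the finite sum of the [a (i - j)] is at most [A]. *)
Lemma sum_le_conv a b A B : (forall i, 0 <= a i) -> (forall i, 0 <= b i) ->
    sum_le a A -> sum_le b B ->
  (forall i, rsummable (fun j => a (i - j) * b j)) /\
  sum_le (fun i => rsum (fun j => a (i - j) * b j)) (A * B).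
Proof.
move=> a0 b0 aA bB.
have ab0 i j : 0 <= a (i - j) * b j by rewrite mulr_ge0.
have A0 := sum_le_ge0 a0 aA.
have sab i : rsummable (fun j => a (i - j) * b j).
  exists (A * B); apply: sum_le_mono (sum_leZ A0 b0 bB) => // j.
  by rewrite ler_wpM2r// (sum_le_term a0 aA).
split=> //; apply/sum_leP => [i|X]; first exact: rsum_ge0.
rewrite -lee_fin -sumEFin; under eq_bigr do rewrite EFin_rsum//.
rewrite -esum_sum => [|i j _ _]; last by rewrite lee_fin.
under eq_esum do rewrite sumEFin.
apply: sum_le_mono (sum_leZ A0 b0 bB) => // j.
rewrite -mulr_suml ler_wpM2r//.
have /sum_leP := sum_le_shift j a0 aA.
by apply.
Qed.

Variables (p : nat) (Q : S -> R) (gamma : R).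
Hypotheses (Q0 : forall i, 0 <= Q i) (gamma0 : 0 <= gamma).
Hypothesis Qgamma : sum_le (fun i => Num.sqrt (Q i) ^+ p.+3)
  (Num.sqrt gamma ^+ p.+3).

(* Young's inequality for the exponents [(d+1)/2], [(d+1)/d], [d+1]: split
   [Q = sqrt Q * sqrt Q] and apply Hoelder to [sqrt Q * w], [sqrt Q] and
   [p.+1] copies of [u]. *)
Lemma young (w u : S -> R) W U : (forall i, 0 <= w i) -> (forall i, 0 <= u i) ->
    0 <= W -> 0 <= U ->
    sum_le (fun i => w i ^+ p.+3) (W ^+ p.+3) ->
    sum_le (fun i => u i ^+ p.+3) (U ^+ p.+3) ->
  (forall i, rsummable (fun j => Q (i - j) * (w j * u j ^+ p.+1))) /\
  sum_le (fun i => rsum (fun j => Q (i - j) * (w j * u j ^+ p.+1)) ^+ p.+3)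
    ((gamma * W * U ^+ p.+1) ^+ p.+3).
Proof.
move=> w0 u0 W0 U0 wW uU; set q := fun i => Num.sqrt (Q i).
have q0 i : 0 <= q i by exact: sqrtr_ge0.
have [sqw qw] := sum_le_conv (fun i => exprn_ge0 p.+3 (q0 i))
  (fun i => exprn_ge0 p.+3 (w0 i)) Qgamma wW.
set c := fun i => rsum _ in qw.
have c0 i : 0 <= c i by apply: rsum_ge0 => j; rewrite mulr_ge0 ?exprn_ge0.
(* [r] is the root of [c i], that is, the norm of the first Hölder factor. The power [p.+3] of the
   resulting bound is a constant times [c i], and summing over [i] is the l^1 convolution bound
   [qw]. *)
have H i : sum_le (fun j => Q (i - j) * (w j * u j ^+ p.+1))
    (sval (cid2 (nth_root_exists p.+2 (c0 i))) * Num.sqrt gamma * U ^+ p.+1).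
  case: cid2 => /= r r0 rc.
  apply: sum_le_mono (sum_hoelder3 (f := fun j => q (i - j) * w j)
    (g := fun j => q (i - j)) _ _ u0 r0 _ U0 _ _ uU) => // [j|j||].
  - by rewrite [q _ * _ * _]mulrAC -expr2 sqr_sqrtr// mulrA.
  - by rewrite mulr_ge0.
  - rewrite rc; apply: sum_le_mono (sum_le_rsum _ (sqw i)) => // [j|j].
      by rewrite exprMn.
    by rewrite mulr_ge0 ?exprn_ge0.
  - exact: (sum_le_reflect _ (fun i => exprn_ge0 p.+3 (q0 i))).
split=> [i|]; first exact: sum_le_rsummable (H i).
have K0 : 0 <= (Num.sqrt gamma * U ^+ p.+1) ^+ p.+3.
  by rewrite exprn_ge0// mulr_ge0 ?sqrtr_ge0// exprn_ge0.
apply: sum_le_mono (sum_leZ K0 c0 qw) => [i|].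
- have := H i; case: cid2 => /= r r0 <- Hi.
  rewrite -exprMn lerXn2r ?nnegrE ?rsum_ge0//.
  + by move=> j; rewrite !mulr_ge0// exprn_ge0.
  + by rewrite !mulr_ge0 ?sqrtr_ge0// exprn_ge0.
  + rewrite mulrC mulrA; apply: rsum_le Hi => j.
    by rewrite !mulr_ge0// exprn_ge0.
- rewrite -!exprMn le_eqVlt; apply/predU1P; left; congr (_ ^+ _).
  by rewrite -[in RHS](sqr_sqrtr gamma0); ring.
Qed.
End Convolution.
End RealSum.

(** * The contraction *)

Lemma normr_subX_le (R : realDomainType) (x y : R) n : 0 <= x -> 0 <= y ->
  `|x ^+ n.+1 - y ^+ n.+1| <= n.+1%:R * `|x - y| * Num.max x y ^+ n.
Proof.
move=> x0 y0; rewrite subrXX normrM [n.+1%:R * _]mulrC -mulrA ler_wpM2l//.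
rewrite (le_trans (ler_norm_sum _ _ _))//.
rewrite [leRHS](_ : _ = \sum_(i < n.+1) Num.max x y ^+ n); last first.
  by rewrite sumr_const card_ord mulr_natl.
apply: ler_sum => i _; rewrite ger0_norm ?mulr_ge0 ?exprn_ge0//.
have z0 : 0 <= Num.max x y by rewrite le_max x0.
have -> : Num.max x y ^+ n = Num.max x y ^+ (n - i) * Num.max x y ^+ i.
  by rewrite -exprD subnK// -ltnS.
by rewrite ler_pM ?exprn_ge0// lerXn2r ?nnegrE// le_max lexx ?orbT.
Qed.

(** A form of Fatou's lemma: by [sum_leP] only finite sums have to pass to the limit. *)
Lemma sum_le_lim (R : realType) (T : choiceType) (f : nat -> T -> R) (g : T -> R)
    (B : R) :
    (forall n i, 0 <= f n i) -> (forall i, f n i @[n --> \oo] --> g i) ->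
    (forall n, sum_le (f n) B) ->
  sum_le g B.
Proof.
move=> f0 fg fB; have g0 i : 0 <= g i.
  by apply: (cvgr_to_ge (fg i)); apply: nearW.
apply/sum_leP => // X; apply: (@cvgr_to_le _ \oo _ _ (fun n => \sum_(i <- X) f n i)).
  elim: (X : seq T) => [|i s IH].
    by under eq_fun do rewrite big_nil; rewrite big_nil; exact: cvg_cst.
  by under eq_fun do rewrite big_cons; rewrite big_cons; exact: cvgD.
by apply: nearW => n; have /sum_leP := fB n; apply.
Qed.

(** The limit is the supremum of the lower bounds [u m - theta ^+ m * c], each of which lies below
    every upper bound [u n + theta ^+ n * c]; the rate comes along for all [n]. *)
Lemma geometric_cauchy_lim (R : realType) (u : nat -> R) (theta c : R) :
    0 <= theta < 1 -> (forall m n, `|u (m + n)%N - u n| <= theta ^+ n * c) ->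
  exists l, forall n, `|l - u n| <= theta ^+ n * c.
Proof.
move=> /andP[t0 t1] uc.
have le m n : u m - theta ^+ m * c <= u n + theta ^+ n * c.
  case: (leqP m n) => [mn|/ltnW mn].
    have := uc (n - m)%N m; rewrite subnK// ler_distl => /andP[h _].
    apply: le_trans h _; rewrite lerDl.
    by apply: le_trans (uc 0%N n); rewrite normr_ge0.
  have := uc (m - n)%N n; rewrite subnK// ler_distl => /andP[_ h].
  apply: le_trans h; rewrite gerDl oppr_le0.
  by apply: le_trans (uc 0%N m); rewrite normr_ge0.
pose E := range (fun m => u m - theta ^+ m * c).
have E0 : E !=set0 by exists (u 0%N - theta ^+ 0 * c); exists 0%N.
exists (sup E) => n; rewrite ler_distl; apply/andP; split.
  apply: ub_le_sup; last by exists n.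
  by exists (u 0%N + theta ^+ 0 * c) => _ [m _ <-].
by apply: ge_sup => // _ [m _ <-].
Qed.

Section FixedPoint.
Context {R : realType} {S : zmodType} (p : nat) (Q : S -> R) (gamma delta eps : R).
Hypotheses (Qpos : forall i, 0 < Q i) (gamma0 : 0 <= gamma) (delta0 : 0 <= delta)
  (eps0 : 0 < eps).
Hypothesis Qgamma : sum_le (fun i => Num.sqrt (Q i) ^+ p.+3)
  (Num.sqrt gamma ^+ p.+3).
Let Qd (i : S) := if i == 0 then 0 else Q i.
Hypothesis Qdelta : sum_le (fun i => Qd i ^+ p.+3) (delta ^+ p.+3).

Let Q0 i : 0 <= Q i. Proof. exact: ltW. Qed.

Let Qd0 i : 0 <= Qd i. Proof. by rewrite /Qd; case: ifP. Qed.

Let N (x : S -> R) i := rsum (fun j => Q (i - j) * x j ^+ p.+2).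
Let D (x : S -> R) := 1 + rsum (fun j => Qd j * x j ^+ p.+2).
(** The entry at [0] stays [0]: the normalisation x(0) = 1 is already contained in the terms [Q i]
    and [1] of numerator and denominator, and only the small part off [0] is iterated. *)
Let T (x : S -> R) (i : S) := if i == 0 then 0 else (Q i + N x i) / D x.

Definition lp_ball (x : S -> R) B := (forall i, 0 <= x i) /\
  sum_le (fun i => x i ^+ p.+3) (B ^+ p.+3).

Lemma ball_N x B : 0 <= B -> lp_ball x B ->
  (forall i, rsummable (fun j => Q (i - j) * x j ^+ p.+2)) /\
  lp_ball (N x) (gamma * B ^+ p.+2).
Proof.
move=> B0 [x0 xB].
have [H1 H2] := young Q0 gamma0 Qgamma x0 x0 B0 B0 xB xB.
split => [i|]; last split.
- by have [C HC] := H1 i; exists C; apply: sum_le_mono HC => // j; rewrite exprS.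
- by move=> i; apply: rsum_ge0 => j; rewrite mulr_ge0// exprn_ge0.
- apply: sum_le_mono H2 => [i|]; last by rewrite -mulrA -exprS.
  by rewrite /N; under eq_fun do rewrite exprS.
Qed.

Lemma ball_D x B : 0 <= B -> lp_ball x B ->
  sum_le (fun j => Qd j * x j ^+ p.+2) (delta * B ^+ p.+2).
Proof.
move=> B0 [x0 xB].
apply: sum_le_mono (sum_hoelder3 Qd0 x0 x0 delta0 B0 B0 Qdelta xB xB) => // [i|].
  by rewrite -mulrA -exprS.
by rewrite -mulrA -exprS.
Qed.

Let D_ge1 x : (forall i, 0 <= x i) -> 1 <= D x.
Proof.
by move=> x0; rewrite lerDl rsum_ge0// => i; rewrite mulr_ge0// exprn_ge0.
Qed.

Let N_ge0 x i : (forall i, 0 <= x i) -> 0 <= N x i.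
Proof. by move=> x0; rewrite rsum_ge0// => j; rewrite mulr_ge0// exprn_ge0. Qed.

Let T_ge0 x i : (forall i, 0 <= x i) -> 0 <= T x i.
Proof.
move=> x0; rewrite /T; case: ifP => // _.
by apply: divr_ge0 (addr_ge0 (Q0 i) (N_ge0 i x0)) (le_trans ler01 (D_ge1 x0)).
Qed.

(** As [D x >= 1], [T x] is pointwise at most [Qd + N x], to which Minkowski applies. *)
Lemma ball_T x B : 0 <= B -> lp_ball x B ->
  lp_ball (T x) (delta + gamma * B ^+ p.+2).
Proof.
move=> B0 xB; have [_ [N0 NB]] := ball_N B0 xB; have [x0 _] := xB.
split=> [i|]; first exact: T_ge0.
apply: sum_le_mono (sum_minkowski Qd0 N0 delta0 _ Qdelta NB) => // [i|]; last first.
  by rewrite mulr_ge0 ?exprn_ge0.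
rewrite lerXn2r ?nnegrE ?T_ge0 ?addr_ge0//.
rewrite /T /Qd; case: ifP => // _.
  by rewrite add0r N_ge0.
by rewrite ler_piMr ?addr_ge0 ?N_ge0// invf_le1 ?D_ge1// (lt_le_trans ltr01) ?D_ge1.
Qed.

Let theta := 2 * p.+2%:R * gamma * eps ^+ p.+1 + 2 * p.+2%:R * delta * eps ^+ p.+2.

Let ball_diff (x y : S -> R) B := sum_le (fun i => `|x i - y i| ^+ p.+3) (B ^+ p.+3).

Hypothesis epsT : delta + gamma * eps ^+ p.+2 <= eps.

Lemma lp_ball_le x A B : 0 <= A -> A <= B -> lp_ball x A -> lp_ball x B.
Proof.
move=> A0 AB [x0 xA]; split=> //; apply: sum_le_mono xA => //.
by rewrite lerXn2r// nnegrE (le_trans A0).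
Qed.

Let T_stable x : lp_ball x eps -> lp_ball (T x) eps.
Proof.
move/(ball_T (ltW eps0)); apply: lp_ball_le => //.
by rewrite addr_ge0// mulr_ge0// exprn_ge0// ltW.
Qed.

(* [max (x, y)] lies in the ball of radius [2^(1/n) eps]; the factor
   [(2^(1/n))^(n-2) <= 2] accounts for the constant [2] in [theta]. *)
Lemma T_contraction x y W : 0 <= W -> lp_ball x eps -> lp_ball y eps ->
  ball_diff x y W -> ball_diff (T x) (T y) (theta * W).
Proof.
move=> W0 xB yB xyW; have [[x0 xe] [y0 ye]] := (xB, yB).
have e0 := ltW eps0.
have [rho rho0 rho2] := @nth_root_exists R p.+2 2 (ler0n _ _).
have rho1 : 1 <= rho.
  by rewrite -(@ler_pXn2r _ p.+3)// ?nnegrE// expr1n rho2 ler1n.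
have rhop : rho ^+ p.+1 <= 2.
  by rewrite -rho2 ler_weXn2l// -addn2 leq_addr.
pose z i := Num.max (x i) (y i).
have z0 i : 0 <= z i by rewrite le_max x0.
have zB : sum_le (fun i => z i ^+ p.+3) ((rho * eps) ^+ p.+3).
  apply: sum_le_mono (sum_leD _ _ xe ye) => [i||i|i]; rewrite ?exprn_ge0//.
    by rewrite /z; case: (leP (x i) (y i)) => _;
      [rewrite ler_wpDl ?exprn_ge0|rewrite ler_wpDr ?exprn_ge0].
  by rewrite exprMn rho2 mulr_natl mulr2n.
pose w i := p.+2%:R * `|x i - y i|.
have w0 i : 0 <= w i by rewrite mulr_ge0.
have wB : sum_le (fun i => w i ^+ p.+3) ((p.+2%:R * W) ^+ p.+3).
  apply: sum_le_mono (sum_leZ (exprn_ge0 p.+3 (ler0n R p.+2)) _ xyW) => [i||i].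
  - by rewrite exprMn.
  - by rewrite exprMn.
  - by rewrite exprn_ge0.
have pW0 : 0 <= p.+2%:R * W by rewrite mulr_ge0.
have re0 : 0 <= rho * eps by rewrite mulr_ge0.
have xyz i : `|x i ^+ p.+2 - y i ^+ p.+2| <= w i * z i ^+ p.+1.
  exact: normr_subX_le.
have wz0 i : 0 <= w i * z i ^+ p.+1 by rewrite ?(exprn_ge0, mulr_ge0).
have [sx _] := ball_N e0 xB; have [sy [_ _]] := ball_N e0 yB.
have [sN NB] := young Q0 gamma0 Qgamma w0 z0 pW0 re0 wB zB.
pose M i := rsum (fun j => Q (i - j) * (w j * z j ^+ p.+1)).
have M0 i : 0 <= M i by apply: rsum_ge0 => j; rewrite mulr_ge0.
have NM i : `|N x i - N y i| <= M i.
  apply: rsum_dist => // [j|j|]; rewrite ?(exprn_ge0, mulr_ge0)//.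
  apply: sum_le_mono (sum_le_rsum _ (sN i)) => // j; last by rewrite mulr_ge0.
  by rewrite -mulrBr normrM ger0_norm// ler_wpM2l.
have DB : `|D x - D y| <= delta * (p.+2%:R * W) * (rho * eps) ^+ p.+1.
  rewrite opprD addrACA subrr add0r.
  apply: rsum_dist => // [j|j|||]; rewrite ?(exprn_ge0, mulr_ge0)//.
  - exact: sum_le_rsummable (ball_D e0 xB).
  - exact: sum_le_rsummable (ball_D e0 yB).
  - apply: sum_le_mono (sum_hoelder3 Qd0 w0 z0 delta0 pW0 re0 Qdelta wB zB) => // j.
    by rewrite -mulrBr normrM ger0_norm// -mulrA ler_wpM2l.
have [Ty0 TyB] := T_stable yB.
have Tdiff i : `|T x i - T y i| <= M i + `|D x - D y| * T y i.
  rewrite /T; case: eqP => _; first by rewrite subrr normr0 addr_ge0 ?mulr_ge0.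
  have Dx := D_ge1 x0; have Dy := D_ge1 y0.
  have Dx0 := lt_le_trans ltr01 Dx; have Dy0 := lt_le_trans ltr01 Dy.
  (* Written this way the difference of the denominators multiplies [T y i], which lies in the ball
     of radius [eps]; this supplies the extra factor [eps] in the second term of [theta]. *)
  have -> : (Q i + N x i) / D x - (Q i + N y i) / D y =
    ((N x i - N y i) - (D x - D y) * ((Q i + N y i) / D y)) / D x.
    by field; rewrite !gt_eqF.
  rewrite normrM (@ger0_norm _ (D x)^-1) ?invr_ge0 ?(ltW Dx0)//.
  apply: le_trans (ler_piMr _ _) _ => //; first by rewrite invf_le1.
  rewrite (le_trans (ler_normB _ _))// lerD// normrM.
  by rewrite (ger0_norm (divr_ge0 (addr_ge0 (Q0 i) (N_ge0 i y0)) (ltW Dy0))).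
pose E := delta * (p.+2%:R * W) * (2 * eps ^+ p.+1).
have E0 : 0 <= E by rewrite !(exprn_ge0, mulr_ge0).
have repE : (rho * eps) ^+ p.+1 <= 2 * eps ^+ p.+1.
  by rewrite exprMn ler_wpM2r ?exprn_ge0.
have DE : `|D x - D y| <= E by rewrite (le_trans DB)// ler_wpM2l ?mulr_ge0.
have TE : sum_le (fun i => (E * T y i) ^+ p.+3) ((E * eps) ^+ p.+3).
  apply: sum_le_mono (sum_leZ (exprn_ge0 p.+3 E0) _ TyB) => [i||i].
  - by rewrite -exprMn.
  - by rewrite -exprMn.
  - by rewrite exprn_ge0.
have ETy i : 0 <= E * T y i := mulr_ge0 E0 (Ty0 i).
have B0 : 0 <= gamma * (p.+2%:R * W) * (rho * eps) ^+ p.+1.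
  by rewrite mulr_ge0 ?exprn_ge0// mulr_ge0.
have Ee0 : 0 <= E * eps by rewrite mulr_ge0.
apply: sum_le_mono (sum_minkowski M0 ETy B0 Ee0 NB TE) => [i|].
  apply: lerXn2r; rewrite ?nnegrE//; first exact: addr_ge0.
  by apply: le_trans (Tdiff i) _; rewrite lerD2l ler_wpM2r.
have le1 : gamma * (p.+2%:R * W) * (rho * eps) ^+ p.+1 <=
    gamma * (p.+2%:R * W) * (2 * eps ^+ p.+1) by rewrite ler_wpM2l ?mulr_ge0.
have tE : gamma * (p.+2%:R * W) * (2 * eps ^+ p.+1) + E * eps = theta * W.
  by rewrite /E /theta [eps ^+ p.+2]exprS; ring.
apply: lerXn2r; rewrite ?nnegrE; first exact: addr_ge0.
  by rewrite -tE (le_trans (addr_ge0 B0 Ee0))// lerD2r.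
by rewrite -tE lerD2r.
Qed.

Hypothesis theta1 : theta < 1.

Let theta0 : 0 <= theta.
Proof. by rewrite addr_ge0// !(exprn_ge0, mulr_ge0)// ltW. Qed.

(** Picard iteration from [0], with limits taken coordinatewise; [sum_le_lim] carries the ball and
    the geometric rate over to the limit. *)
Lemma fixed_point_exists : exists x, lp_ball x eps /\ forall i, T x i = x i.
Proof.
pose x m := iter m T (fun=> 0).
have xB m : lp_ball (x m) eps.
  elim: m => [|m]; last exact: T_stable.
  split=> //=; rewrite /sum_le esum1 ?lee_fin ?exprn_ge0 ?(ltW eps0)//.
  by move=> i _; rewrite expr0n.
have xx m n : ball_diff (x (m + n)%N) (x n) (theta ^+ n * eps).
  elim: n => [|n IH].
    rewrite addn0 expr0 mul1r; apply: sum_le_mono (xB m).2 => // i.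
    by rewrite subr0 ger0_norm// (xB m).1.
  rewrite addnS exprS -mulrA; apply: T_contraction => //.
  exact: mulr_ge0 (exprn_ge0 n theta0) (ltW eps0).
have ptw (f g : S -> R) B i : 0 <= B -> ball_diff f g B -> `|f i - g i| <= B.
  move=> B0 /sum_le_term => /(_ (fun i => exprn_ge0 _ (normr_ge0 _)) i).
  by rewrite ler_pXn2r ?nnegrE.
have te0 n : 0 <= theta ^+ n * eps := mulr_ge0 (exprn_ge0 n theta0) (ltW eps0).
have /choice[X XE] i : exists l, forall n, `|l - x n i| <= theta ^+ n * eps.
  apply: geometric_cauchy_lim; first by rewrite theta0.
  by move=> m n; exact: ptw.
have te_cvg : theta ^+ n * eps @[n --> \oo] --> (0 : R).
  rewrite -(mul0r eps); apply: cvgM; last exact: cvg_cst.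
  by apply: cvg_expr; rewrite ger0_norm.
have xX i : x n i @[n --> \oo] --> X i.
  apply: (@squeeze_cvgr _ _ _ _ (fun n => X i - theta ^+ n * eps)
    (fun n => X i + theta ^+ n * eps)).
  - by apply: nearW => n; have := XE i n; rewrite distrC ler_distl.
  - by rewrite -[X in _ --> X]subr0; apply: cvgB => //; exact: cvg_cst.
  - by rewrite -[X in _ --> X]addr0; apply: cvgD => //; exact: cvg_cst.
have expr_cvg (u : nat -> R) (l : R) : u n @[n --> \oo] --> l ->
    u n ^+ p.+3 @[n --> \oo] --> l ^+ p.+3.
  move=> ul; exact: (cvg_comp u (fun y => y ^+ p.+3) ul (@exprn_continuous R p.+3 l)).
have XB : lp_ball X eps.
  split=> [i|].
    by apply: (cvgr_to_ge (xX i)); apply: nearW => n; exact: (xB n).1.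
  apply: (@sum_le_lim _ _ (fun n i => x n i ^+ p.+3)) => [n i|i|n].
  - by rewrite exprn_ge0// (xB n).1.
  - exact: expr_cvg.
  - exact: (xB n).2.
have Xx n : ball_diff X (x n) (theta ^+ n * eps).
  apply: (@sum_le_lim _ _ (fun m i => `|x (m + n)%N i - x n i| ^+ p.+3)) => [m i|i|m].
  - by rewrite exprn_ge0.
  - apply: expr_cvg; apply: cvg_norm; apply: cvgB; last exact: cvg_cst.
    by have := xX i; rewrite -(cvg_shiftn n (fun m => x m i)).
  - exact: xx.
exists X; split=> // i; apply/eqP; rewrite -subr_eq0 -normr_le0.
(* [T X i] and [X i] are both within [theta ^+ n * eps] of [x n.+1 i]. *)
have t2 : theta ^+ n * eps * 2 @[n --> \oo] --> (0 : R).
  by rewrite -(mul0r 2); apply: cvgM => //; exact: cvg_cst.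
apply: (cvgr_to_ge t2); apply: nearW => n.
apply: (@le_trans _ _ (`|T X i - x n.+1 i| + `|X i - x n.+1 i|)).
  by rewrite [X in _ <= _ + X]distrC; exact: ler_distD.
rewrite mulr_natr mulr2n lerD//.
  apply: le_trans (ptw _ _ _ i _ (T_contraction _ XB (xB n) (Xx n))) _ => //.
    by rewrite mulr_ge0.
  by rewrite ler_piMl// ltW.
apply: le_trans (XE i n.+1) _.
by rewrite exprS -mulrA ler_piMl// ltW.
Qed.
End FixedPoint.

(** * The boundary law *)

(* Knaster-Tarski: the infimum of the points where [g e ^+ d + dl] is below
   the identity is a fixed point. *)
Lemma smallest_solution (R : realType) d (g dl e0 : R) : 0 <= g -> 0 < dl ->
    0 < e0 -> dl + g * e0 ^+ d <= e0 ->
  exists2 eps, is_smallest_positive_solution d g dl eps & eps <= e0.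
Proof.
move=> g0 dl0 e00 He0.
pose E := [set e : R | 0 <= e /\ dl + g * e ^+ d <= e].
have Ee0 : E e0 by split=> //; exact: ltW.
have hE : has_inf E.
  by split; [exists e0|exists 0 => e []].
set a := inf E.
have a_le e : E e -> a <= e by move=> Ee; apply: ge_inf => //; exact: hE.2.
have a0 : 0 <= a by apply: lb_le_inf; [exists e0|move=> e []].
have f_le e e' : 0 <= e -> e <= e' -> dl + g * e ^+ d <= dl + g * e' ^+ d.
  by move=> e0' ee'; rewrite lerD2l ler_wpM2l// lerXn2r// nnegrE (le_trans e0').
have fa : dl + g * a ^+ d <= a.
  apply: lb_le_inf; first by exists e0.
  by move=> e Ee; apply: le_trans Ee.2; apply: f_le => //; exact: a_le.
have fa0 : 0 <= dl + g * a ^+ d by rewrite addr_ge0 ?mulr_ge0 ?exprn_ge0// ltW.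
have af : a <= dl + g * a ^+ d by apply: a_le; split=> //; exact: f_le.
have aE : a = g * a ^+ d + dl by rewrite addrC; apply/le_anti; rewrite af fa.
exists a; last exact: a_le.
split=> //.
  by rewrite aE ltr_wpDl// mulr_ge0 ?exprn_ge0.
by move=> e e_gt0 ee; apply: a_le; split; [exact: ltW|rewrite addrC -ee].
Qed.

(** Separates the term at [u = 0], turning sums over the boundary law, with value [1] at [0], into
    sums over the fixed point, with value [0] there. *)
Lemma rsum_split (R : realType) (S : zmodType) (u : S) (f g : S -> R) (a : R) :
    0 <= a -> (forall i, 0 <= f i) -> (forall i, 0 <= g i) -> rsummable g ->
    g u = 0 -> f u = a -> (forall i, i != u -> f i = g i) ->
  (\esum_(i in setT) (f i)%:E)%E = (a + rsum g)%:E.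
Proof.
move=> a0 f0 g0 sg gu fu fg.
rewrite EFinD EFin_rsum//.
have -> : (a%:E = \esum_(i in [set: S]) (if i \in [set u] then a%:E else 0))%E.
  by rewrite -esum_mkcond esum_set1.
rewrite -esumD => [|i _|i _]; last 2 first.
- by case: ifP; rewrite ?lee_fin.
- by rewrite lee_fin.
apply: eq_esum => i _; case: (eqVneq i u) => [->|iu].
  by rewrite mem_set// gu fu adde0.
by rewrite memNset ?fg ?add0e// => /eqP; rewrite (negPf iu).
Qed.

Section BoundaryLaw.
Context {R : realType} {S : zmodType} (p : nat) (Q : S -> R) (gamma delta eps : R).
Hypotheses (Qpos : forall i, 0 < Q i) (Qeven : forall i, Q (- i) = Q i) (Q1 : Q 0 = 1)
  (gamma1 : 1 <= gamma) (delta0 : 0 <= delta) (eps0 : 0 < eps).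
Hypothesis Qgamma : sum_le (fun i => Num.sqrt (Q i) ^+ p.+3)
  (Num.sqrt gamma ^+ p.+3).
Let Qd (i : S) := if i == 0 then 0 else Q i.
Hypothesis Qdelta : sum_le (fun i => Qd i ^+ p.+3) (delta ^+ p.+3).
(** With [Qdelta] this says that [delta] is exactly the norm of [Qd]; the lower bound on the
    marginal depends on it. *)
Hypothesis Qdelta_ge : forall B, 0 <= B -> sum_le (fun i => Qd i ^+ p.+3) (B ^+ p.+3) ->
  delta <= B.
Hypothesis epsT : delta + gamma * eps ^+ p.+2 <= eps.
Hypothesis theta1 :
  2 * p.+2%:R * gamma * eps ^+ p.+1 + 2 * p.+2%:R * delta * eps ^+ p.+2 < 1.

Let Q0 i : 0 <= Q i. Proof. exact: ltW. Qed.
Let Qd0 i : 0 <= Qd i. Proof. by rewrite /Qd; case: ifP. Qed.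
Let gamma0 : 0 <= gamma. Proof. exact: le_trans ler01 gamma1. Qed.

Let a_ge0 : 0 <= gamma * eps ^+ p.+1.
Proof. by rewrite mulr_ge0// exprn_ge0// ltW. Qed.

Let b_ge0 : 0 <= delta * eps ^+ p.+2.
Proof. by rewrite mulr_ge0// exprn_ge0// ltW. Qed.

Let ab_lt : gamma * eps ^+ p.+1 + delta * eps ^+ p.+2 < 1.
Proof.
apply: le_lt_trans theta1.
rewrite -!(mulrA (2 * _)) -mulrDr ler_peMl ?addr_ge0//.
by rewrite -natrM ler1n.
Qed.

Lemma boundary_law_exists : exists (x : S -> R) (D X : R),
  [/\ x 0 = 1, 0 < D & forall i, 0 < x i] /\
  [/\ forall i, i != 0 -> x i < 1,
      forall i, (\esum_(j in setT) (Q (i - j) * x j ^+ p.+2)%:E)%E = (D * x i)%:E,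
      (\esum_(j in setT) (x j ^+ p.+3)%:E)%E = (1 + X)%:E &
      (delta * ((1 - delta * eps ^+ p.+2) / (1 + gamma * eps ^+ p.+1))) ^+ p.+3 <= X <=
      (delta * ((1 + delta * eps ^+ p.+2) / (1 - gamma * eps ^+ p.+1))) ^+ p.+3].
Proof.
have [y [[y0 yB] yT]] :=
  fixed_point_exists Qpos gamma0 delta0 eps0 Qgamma Qdelta epsT theta1.
have y00 : y 0 = 0 by rewrite -(yT 0) eqxx.
have e0 := ltW eps0.
have [sN _] := ball_N Qpos gamma0 Qgamma e0 (conj y0 yB).
have Qy0 i j : 0 <= Q (i - j) * y j ^+ p.+2 by rewrite mulr_ge0 ?exprn_ge0.
have Qdy0 j : 0 <= Qd j * y j ^+ p.+2 by rewrite mulr_ge0 ?exprn_ge0.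
pose D := 1 + rsum (fun j => Qd j * y j ^+ p.+2).
have D1 : 1 <= D by rewrite lerDl rsum_ge0.
have D0 : 0 < D := lt_le_trans ltr01 D1.
pose x i := if i == 0 then 1 else y i.
have x0 i : 0 <= x i by rewrite /x; case: ifP.
have xE i : i != 0 -> Q i + rsum (fun j => Q (i - j) * y j ^+ p.+2) = D * y i.
  move=> i0; rewrite -[in RHS](yT i) (negPf i0) -/Qd -/D mulrCA mulfV ?gt_eqF//.
  by rewrite mulr1.
have yn0 i : 0 <= y i ^+ p.+3 by rewrite exprn_ge0.
have sy := sum_le_rsummable yB.
have X0 := rsum_ge0 yn0.
have [xi xi0 xiX] := nth_root_exists p.+2 X0.
have yxi : sum_le (fun i => y i ^+ p.+3) (xi ^+ p.+3).
  by rewrite xiX; exact: sum_le_rsum.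
have xi_eps : xi <= eps.
  rewrite -(@ler_pXn2r _ p.+3) ?nnegrE// xiX; exact: rsum_le.
have root_le (C : R) : 0 <= C -> sum_le (fun i => y i ^+ p.+3) (C ^+ p.+3) ->
    xi <= C.
  by move=> C0 yC; rewrite -(@ler_pXn2r _ p.+3) ?nnegrE// xiX; exact: rsum_le.
exists x, D, (rsum (fun i => y i ^+ p.+3)); split; split=> //.
- by rewrite /x eqxx.
- move=> i; rewrite /x; case: eqVneq => // i0.
  by rewrite -(pmulr_rgt0 _ D0) -xE// ltr_pwDl// rsum_ge0.
- move=> i i0; rewrite /x (negPf i0).
  (* An entry is at most the norm, and [eps < 1]: since [gamma >= 1], [eps >= 1] would contradict
     [ab_lt]. The strict bound will tell the measures apart. *)
  have ye : y i <= eps.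
    by rewrite -(@ler_pXn2r _ p.+3) ?nnegrE//; exact: (sum_le_term yn0 yB).
  apply: (le_lt_trans ye); rewrite ltNge; apply/negP => e1.
  have : 1 <= gamma * eps ^+ p.+1 by rewrite mulr_ege1// exprn_ege1.
  by rewrite leNgt => /negP; apply; apply: le_lt_trans ab_lt; rewrite lerDl.
- move=> i.
  rewrite (@rsum_split _ _ 0 _ (fun j => Q (i - j) * y j ^+ p.+2) (Q i))//.
  + congr (_%:E); rewrite /x; case: eqVneq => [->|i0]; last exact: xE.
    rewrite Q1 mulr1 /D; congr (_ + _); congr fine; apply: eq_esum => j _.
    rewrite sub0r Qeven /Qd; case: eqVneq => // ->.
    by rewrite y00 expr0n/= mulr0 mul0r.
  + by move=> j; rewrite mulr_ge0// exprn_ge0.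
  + by rewrite y00 expr0n mulr0.
  + by rewrite subr0 /x eqxx expr1n mulr1.
  + by move=> j j0; rewrite /x (negPf j0).
- rewrite (@rsum_split _ _ 0 _ (fun j => y j ^+ p.+3) 1)//.
  + by move=> j; rewrite exprn_ge0.
  + by rewrite y00 expr0n.
  + by rewrite /x eqxx expr1n.
  + by move=> j j0; rewrite /x (negPf j0).
move: a_ge0 b_ge0 ab_lt => ha hb hab.
set a := gamma * eps ^+ p.+1 in ha hab *; set b := delta * eps ^+ p.+2 in hb hab *.
have a1 : 0 < 1 - a by rewrite subr_gt0; apply: le_lt_trans hab; rewrite lerDl.
have b1 : 0 < 1 - b by rewrite subr_gt0; apply: le_lt_trans hab; rewrite lerDr.
have a2 : 0 < 1 + a by rewrite ltr_pwDl.
have D_le : D <= 1 + b.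
  rewrite lerD2l; apply: rsum_le => //.
  exact: (ball_D Qpos delta0 Qdelta e0 (conj y0 yB)).
have xi_le : xi <= delta + gamma * xi ^+ p.+2.
  apply: root_le => //.
    by apply: addr_ge0 => //; apply: mulr_ge0 => //; exact: exprn_ge0.
  apply: sum_le_mono (ball_T Qpos gamma0 delta0 Qgamma Qdelta xi0 (conj y0 yxi)).2 => //.
  by move=> i; rewrite yT.
have xi_ge : delta <= D * xi.
  apply: Qdelta_ge; first by rewrite mulr_ge0// ltW.
  apply: sum_le_mono (sum_leZ (exprn_ge0 p.+3 (ltW D0)) yn0 yxi) => // [i|].
    rewrite -exprMn; apply: lerXn2r; rewrite ?nnegrE// ?mulr_ge0// ?(ltW D0)//.
    rewrite /Qd; case: eqVneq => [->|i0]; first by rewrite y00 mulr0.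
    by rewrite -xE// lerDl rsum_ge0.
  by rewrite -exprMn.
rewrite -xiX; apply/andP; split.
  have l0 : 0 <= delta * ((1 - b) / (1 + a)).
    by rewrite mulr_ge0// divr_ge0// ltW.
  apply: lerXn2r; rewrite ?nnegrE// mulrA ler_pdivrMr//.
  (* From [delta <= D * xi <= (1 + b) * xi]; the product then collapses to [xi * (1 - b * b)], which
     is at most [xi]. *)
  apply: (@le_trans _ _ ((1 + b) * xi * (1 - b))).
    by rewrite ler_wpM2r ?(ltW b1)// (le_trans xi_ge)// ler_wpM2r.
  have -> : (1 + b) * xi * (1 - b) = xi * (1 - b * b) by ring.
  apply: ler_wpM2l => //; apply: (@le_trans _ _ 1); last by rewrite lerDl.
  by rewrite gerDl oppr_le0 mulr_ge0.
have u0 : 0 <= delta * ((1 + b) / (1 - a)).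
  by rewrite mulr_ge0// divr_ge0 ?(ltW a1)// addr_ge0.
apply: lerXn2r; rewrite ?nnegrE// mulrA ler_pdivlMr//.
(* Since [xi <= eps], [gamma * xi ^+ p.+2] is at most [a * xi], so [xi_le] becomes
   [xi * (1 - a) <= delta]. *)
apply: (@le_trans _ _ delta); last by rewrite ler_peMr// lerDl.
rewrite mulrBr mulr1 lerBlDr; apply: le_trans xi_le _.
rewrite lerD2l.
have -> : xi * a = gamma * (xi * eps ^+ p.+1) by rewrite mulrCA.
apply: ler_wpM2l => //; rewrite exprS; apply: ler_wpM2l => //.
by apply: lerXn2r; rewrite ?nnegrE.
Qed.
End BoundaryLaw.

(** * Measures on sequences over a countable alphabet *)

(** Codes that belong to no element contribute [0]. *)
Lemma esum_countE (R : realType) (S : countType) (f : S -> \bar R) :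
    (forall i, 0 <= f i)%E ->
  (\esum_(i in [set: S]) f i = \sum_(n <oo) oapp f 0 (pickle_inv n))%E.
Proof.
move=> f0; set u := fun n => oapp f 0%E (pickle_inv n).
have u0 n : (0 <= u n)%E by rewrite /u; case: pickle_inv => //=.
rewrite nneseries_esumT//.
rewrite (_ : (\esum_(n in setT) u n = \esum_(n in choice.pickle @` [set: S]) u n)%E).
  rewrite esum_image; last by move=> x y _ _; exact: (pcan_inj choice.pickleK).
  by apply: eq_esum => i _; rewrite /u pickleK_inv.
rewrite [RHS]esum_mkcond; apply: eq_esum => n _; case: ifPn => //.
rewrite notin_setE /= => nS; rewrite /u.
have := pickle_invK (T := S) n; case: pickle_inv => //= i ni.
by exfalso; apply: nS; exists i.
Qed.

Section Subdivision.
Context {R : realType} {S : countType} (f : S -> R) (m : R).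
Hypothesis f0 : forall i, 0 <= f i.
Hypothesis fm : (\esum_(i in setT) (f i)%:E)%E = m%:E.

Let u n := oapp f 0 (pickle_inv n).

(** Left endpoint of the piece of [[0, m)] assigned to the letter [a], the pieces being laid side by
    side in the order of the codes. *)
Definition subdiv (a : S) : R := \sum_(n < choice.pickle a) u n.

Let u0 n : 0 <= u n. Proof. by rewrite /u; case: pickle_inv => //=. Qed.

Let su N := \sum_(n < N) u n.

Let su_mono M N : (M <= N)%N -> su M <= su N.
Proof.
move=> /subnKC <-; rewrite /su big_split_ord/= lerDl.
by rewrite sumr_ge0.
Qed.

Let subdivS a : subdiv a + f a = su (choice.pickle a).+1.
Proof. by rewrite /su big_ord_recr/= {2}/u pickleK_inv. Qed.

Lemma subdiv_ge0 a : 0 <= subdiv a. Proof. by rewrite sumr_ge0. Qed.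

Let series_u : (\sum_(n <oo) (u n)%:E = m%:E)%E.
Proof.
rewrite -fm esum_countE//; apply: eq_eseriesr => n _.
by rewrite /u; case: pickle_inv.
Qed.

Lemma subdiv_le a : subdiv a + f a <= m.
Proof.
rewrite subdivS -lee_fin -series_u /su -sumEFin -(big_mkord xpredT (fun n => (u n)%:E)).
by apply: nneseries_lim_ge => n _; rewrite lee_fin.
Qed.

Lemma subdiv_inj (t : R) a b : subdiv a <= t < subdiv a + f a ->
  subdiv b <= t < subdiv b + f b -> a = b.
Proof.
wlog: a b / (choice.pickle a <= choice.pickle b)%N => [W|ab].
  by case/orP: (leq_total (choice.pickle a) (choice.pickle b)) => ab ha hb;
    [|symmetry]; exact: W.
move=> /andP[_ ha] /andP[hb _]; apply: (pcan_inj choice.pickleK); apply/eqP.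
rewrite eqn_leq ab leqNgt; apply/negP => ba.
by have := le_lt_trans hb ha; rewrite subdivS ltNge su_mono.
Qed.

Lemma subdiv_surj (t : R) : 0 <= t < m -> exists a, subdiv a <= t < subdiv a + f a.
Proof.
move=> /andP[t0 tm].
have exN : exists N, t < su N.
  apply: contrapT => /forallNP tsu; move: tm; apply/negP; rewrite -leNgt.
  rewrite -lee_fin -series_u; apply: lime_le.
    by apply: is_cvg_nneseries => n *; rewrite lee_fin.
  apply: nearW => N; rewrite big_mkord sumEFin lee_fin leNgt; apply/negP; exact: tsu.
case: (ex_minnP exN) => -[|N]; first by rewrite /su big_ord0 ltNge t0.
move=> tN Nmin.
have Nt : su N <= t by rewrite leNgt; apply/negP => /Nmin; rewrite ltnn.
(* The partial sums increase at this [N], so [u N] is not a gap and [N] is the code of a letter. *)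
have : 0 < u N.
  have := le_lt_trans Nt tN; rewrite /su big_ord_recr/= ltrDl //.
rewrite /u; have := pickle_invK (T := S) N.
case: pickle_inv => [a|]; last by rewrite ltxx.
move=> /= aN _; exists a; rewrite subdivS aN tN andbT.
by rewrite /subdiv aN.
Qed.
End Subdivision.

Section WordMeasure.
Context {R : realType} {S : countType}.
Variable p : seq S -> R.
Hypotheses (p0 : forall w, 0 <= p w) (p_nil : p [::] = 1).
Hypothesis p_rcons :
  forall w, (\esum_(a in setT) (p (rcons w a))%:E)%E = (p w)%:E.

(* Words are stored in reverse order. *)
Fixpoint word_left (w : seq S) : R :=
  if w is a :: w' then word_left w' + subdiv (fun b => p (rcons (rev w') b)) a else 0.

Definition word_itv (w : seq S) : set R :=
  `[word_left w, word_left w + p (rev w)[%classic.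

Lemma word_itv_cons w a t : word_itv (a :: w) t ->
  word_itv w t.
Proof.
rewrite /word_itv /= !in_itv/= rev_cons => /andP[h1 h2].
apply/andP; split.
  by apply: le_trans h1; rewrite lerDl subdiv_ge0.
by apply: lt_le_trans h2 _; rewrite -addrA lerD2l (subdiv_le _ (p_rcons _)).
Qed.

Lemma word_itv_inj w a b t : word_itv (a :: w) t -> word_itv (b :: w) t -> a = b.
Proof.
have E c : word_itv (c :: w) t -> subdiv (fun b => p (rcons (rev w) b)) c <=
    t - word_left w < subdiv (fun b => p (rcons (rev w) b)) c + p (rcons (rev w) c).
  by rewrite /word_itv /= in_itv/= rev_cons -addrA -lerBrDl -ltrBlDl.
by move=> /E + /E; apply: subdiv_inj.
Qed.

Lemma word_itv_surj w t : word_itv w t -> exists a, word_itv (a :: w) t.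
Proof.
rewrite /word_itv /= in_itv/= => /andP[h1 h2].
have [|a ha] := @subdiv_surj _ _ _ _ (fun b => p0 (rcons (rev w) b))
  (p_rcons (rev w)) (t - word_left w).
  by rewrite subr_ge0 h1 ltrBlDl.
by exists a; rewrite /= in_itv/= rev_cons -addrA -lerBrDl -ltrBlDl.
Qed.

Variable s0 : S.

(** When [t] lies in the interval of [w] there is exactly one such letter, by [word_itv_surj] and
    [word_itv_inj]; the default [s0] is not reached then. *)
Definition word_next (t : R) (w : seq S) : S := xget s0 [set a | word_itv (a :: w) t].

Definition word_at (t : R) n : seq S := iter n (fun w => word_next t w :: w) [::].

(** Turns an event about the random word into membership in an interval, whose length is the
    prescribed probability. *)
Lemma word_atP t n w : 0 <= t < 1 -> size w = n -> word_at t n = w <-> word_itv w t.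
Proof.
move=> t01; elim: n w => [|n IH] [|a w] //=.
  by rewrite /word_itv/= in_itv/= p_nil add0r.
move=> [sw]; split=> [[<-]|].
  move=> /(IH _ sw) wt; rewrite /word_next (proj2 (IH _ sw) wt).
  case: xgetP => [_ _ //|h]; have [b wb] := word_itv_surj wt; by have := h b.
move=> awt; have wt := word_itv_cons awt.
rewrite (proj2 (IH _ sw) wt); congr (_ :: _).
rewrite /word_next; case: xgetP => [b _ bwt|/(_ a)//].
exact: word_itv_inj bwt awt.
Qed.
End WordMeasure.

Section UniformMeasure.
Context {R : realType}.

Definition unif01 : set (measurableTypeR R) -> \bar R :=
  mrestr lebesgue_measure (measurable_itv `[(0 : R), 1[).

HB.instance Definition _ := Measure.on unif01.

Let unif01_setT : unif01 setT = 1%E.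
Proof.
rewrite /unif01 /mrestr setTI lebesgue_measure_itv/= lte_fin ltr01.
by rewrite oppr0 adde0.
Qed.

HB.instance Definition _ := Measure_isProbability.Build _ _ _ unif01 unif01_setT.

Lemma unif01_itv (a b : R) : 0 <= a -> a <= b -> b <= 1 ->
  unif01 `[a, b[%classic = (b - a)%:E.
Proof.
move=> a0 ab b1; rewrite /unif01 /mrestr setIidl; last first.
  move=> t /=; rewrite !in_itv/= => /andP[h1 h2].
  by rewrite (le_trans a0)//= (lt_le_trans h2).
rewrite lebesgue_measure_itv/= lte_fin; case: ltP => //.
by move=> ba; rewrite (_ : b = a) ?subrr//; apply/le_anti; rewrite ba ab.
Qed.
End UniformMeasure.

Theorem word_measure (R : realType) (S : countType) (s0 : S) (p : seq S -> R) :
    (forall w, 0 <= p w) -> p [::] = 1 ->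
    (forall w, (\esum_(a in setT) (p (rcons w a))%:E)%E = (p w)%:E) ->
  exists (P : probability (measurableTypeR R) R) (X : nat -> R -> S),
    (forall n a, measurable (X n @^-1` [set a] : set (measurableTypeR R))) /\
    (forall w, P [set t | mkseq (X^~ t) (size w) = w] = (p w)%:E).
Proof.
move=> p0 p_nil p_rcons.
(* The letters must be functions on all of [R]; points outside [[0, 1)], a null set for [unif01],
   are read as [0]. *)
pose clip (t : R) : R := if 0 <= t < 1 then t else 0.
have clip01 t : 0 <= clip t < 1 by rewrite /clip; case: ifP => //; rewrite lexx ltr01.
pose W t n := word_at p s0 (clip t) n.
pose X n t := head s0 (W t n.+1).
have WE t n : W t n = rev (mkseq (X^~ t) n).
  elim: n => [//|n IH].
  rewrite -addn1 /mkseq iotaD map_cat rev_cat -IH /=.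
  by rewrite add0n addn1 /X /W /=.
have XwE w : [set t | mkseq (X^~ t) (size w) = w] =
    [set t | word_itv p (rev w) (clip t)].
  apply/seteqP; split => t /=.
    move=> h; apply/(word_atP p0 p_nil p_rcons s0 (n := size w)); rewrite ?size_rev//.
    by rewrite -/(W t _) WE h.
  move=> /(word_atP p0 p_nil p_rcons s0 (n := size w)).
  rewrite size_rev -/(W t _) WE => /(_ (clip01 t) erefl).
  by move=> /(congr1 rev); rewrite !revK.
have Xw_meas w :
    measurable ([set t | mkseq (X^~ t) (size w) = w] : set (measurableTypeR R)).
  rewrite XwE.
  have -> : [set t | word_itv p (rev w) (clip t)] =
     (word_itv p (rev w) `&` `[0, 1[) `|`
     ((if 0 \in word_itv p (rev w) then setT else set0) `&` ~` `[0, 1[%classic).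
    apply/seteqP; split => t /=; rewrite /clip in_itv/=.
      case: ifPn => t01; first by left.
      by move=> h; right; rewrite mem_set.
    move=> [[h ->]//|[]]; case: ifPn => [|_ []].
    by move=> /set_mem h _ /negP/negPf ->.
  apply: measurableU; apply: measurableI; try exact: measurable_itv.
    by case: ifP.
  by apply: measurableC; exact: measurable_itv.
exists (unif01 : probability _ R), X; split.
  move=> n a.
  have -> : X n @^-1` [set a] =
      \bigcup_(w : seq S) ([set t | mkseq (X^~ t) n = w /\ size w = n /\ X n t = a]).
    apply/seteqP; split => [t /= Xa|t [w _ [_ []]]//].
    by exists (mkseq (X^~ t) n) => //; rewrite //= size_mkseq.
  apply: countable_bigcupT_measurable => // w.
  case: (eqVneq (size w) n) => [wn|wn]; last first.
    rewrite (_ : [set _ | _] = set0)// -subset0 => t /= [_ []] /eqP.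
    by rewrite (negPf wn).
  rewrite (_ : [set _ | _] =
    [set t | mkseq (X^~ t) (size (rcons w a)) = rcons w a]); first exact: Xw_meas.
  rewrite size_rcons wn; under [in RHS]eq_set do rewrite mkseqS.
  apply/seteqP; split => t /=; first by move=> [-> [_ ->]].
  by move=> /rcons_inj[-> ->].
move=> w; rewrite XwE.
have r0 v : 0 <= word_left p v.
  by elim: v => //= a v IH; rewrite addr_ge0 ?subdiv_ge0.
have r1 v : word_left p v + p (rev v) <= 1.
  elim: v => /= [|a v IH]; first by rewrite p_nil add0r.
  apply: le_trans IH; rewrite -addrA lerD2l rev_cons.
  by rewrite (subdiv_le _ (p_rcons _)).
rewrite -[in RHS](revK w) -[p _](addKr (word_left p (rev w))) addrC.
rewrite -unif01_itv ?r0 ?r1 ?lerDl// revK.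
rewrite /= /unif01 /mrestr; congr lebesgue_measure.
by apply/seteqP; split => t /= []; rewrite !in_itv/= /clip => + t01;
  rewrite t01 /word_itv /= !in_itv/= revK.
Qed.

(** * Finite subtrees *)

Section Subtrees.
Context {d : nat} {V : choiceType} {nb : V -> {fset V}}.
Hypothesis hV : is_cayley_tree d nb.
Implicit Types (W : {fset V}) (u v x y : V).

Lemma nb_sym x y : (y \in nb x) = (x \in nb y).
Proof. exact: (cayley_sym hV x y). Qed.

Lemma nb_irr x : x \in nb x = false.
Proof. exact: (cayley_irr hV x). Qed.

(** Growth by one vertex at a time matches the one-leaf consistency of the marginals. *)
Inductive subtree : {fset V} -> Prop :=
| subtree1 x : subtree [fset x]%fset
| subtreeU W u v : subtree W -> u \in W -> v \notin W -> v \in nb u ->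
    subtree (v |` W)%fset.

Lemma subtree_neq0 W : subtree W -> exists x, x \in W.
Proof. by case=> [x|{}W u v *]; [exists x|exists v]; rewrite !inE ?eqxx. Qed.

Lemma subtree_path W x y : subtree W -> x \in W -> y \in W ->
  exists p, [/\ path (adj nb) x p, last x p = y & {subset p <= W}].
Proof.
move=> tW; elim: tW x y => [z|{}W u v tW IH uW vW vu] x y.
  by rewrite !inE => /eqP-> /eqP->; exists [::].
rewrite !inE => /orP[/eqP->|xW] /orP[/eqP->|yW].
- by exists [::].
- have [p [p1 p2 p3]] := IH _ _ uW yW.
  exists (u :: p); split=> //=; first by rewrite p1 andbT /adj nb_sym.
  by move=> z; rewrite !inE => /orP[/eqP->|/p3->]; rewrite ?uW orbT.
- have [p [p1 p2 p3]] := IH _ _ xW uW.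
  exists (rcons p v); rewrite last_rcons rcons_path p1 p2; split=> //.
  by move=> z; rewrite mem_rcons !inE => /orP[->//|/p3->]; rewrite orbT.
- have [p [p1 p2 p3]] := IH _ _ xW yW.
  by exists p; split=> // z /p3; rewrite !inE orbC => ->.
Qed.

(** Two distinct neighbours of [v] in [W] are joined by a simple path inside [W], and [v] closes it
    to a cycle. *)
Lemma subtree_nb_uniq W v x y : subtree W -> v \notin W -> x \in W -> y \in W ->
  v \in nb x -> v \in nb y -> x = y.
Proof.
move=> tW vW xW yW vx vy; apply/eqP/negPn/negP => xy.
have [p [+ + pW]] := subtree_path tW xW yW.
case/shortenP => q pq uq qp lq.
apply: (cayley_acyclic hV (c := v :: x :: q)) => //=.
  by case: q lq {pq uq qp} => // /eqP; rewrite (negPf xy).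
rewrite /ucycle; apply/andP; split; last first.
  rewrite cons_uniq uq andbT inE negb_or; apply/andP; split.
    by apply: contraNneq vW => ->.
  by apply: contraNN vW => /qp/pW.
by rewrite /= rcons_path pq lq /adj (nb_sym v) vx vy.
Qed.

(** Connectedness of [W'] in usable form: an edge leaves every nonempty proper subset. It lets a
    subtree be enlarged, leaf by leaf, to an initial segment. *)
Lemma subtree_grow W W' : subtree W' -> (W `<=` W')%fset -> W' != W ->
  (exists x, x \in W) ->
  exists u v, [/\ u \in W, v \in W', v \notin W & v \in nb u].
Proof.
move=> tW'; elim: tW' W => [z|{}W' u v tW' IH uW' vW' vu] W WW' neq [x xW].
  exfalso; move/eqP: neq; apply; apply/eqP; rewrite eqEfsubset WW' andbT.
  by rewrite fsub1set; move: (fsubsetP WW' _ xW); rewrite inE => /eqP <-.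
case: (boolP (v \in W)) => vW; last first.
  have WW : (W `<=` W')%fset.
    apply/fsubsetP => y yW; move: (fsubsetP WW' _ yW); rewrite !inE.
    by case: eqVneq => // yv; rewrite -yv yW in vW.
  case: (eqVneq W' W) => [E|neq']; first by exists u, v; rewrite -E !inE eqxx.
  have [u' [v' [h1 h2 h3 h4]]] := IH _ WW neq' (ex_intro _ x xW).
  by exists u', v'; rewrite !inE h2 orbT.
(* If [W] misses the old part [W'], it is the single vertex [v], and the edge back to [u] leaves
   it. *)
case: (boolP (W `&` W' == fset0)%fset) => [/eqP E|/fset0Pn[y yW]].
  exists v, u; rewrite !inE uW' orbT nb_sym; split=> //.
  apply/negP => uW; have : u \in (W `&` W')%fset by rewrite inE uW uW'.
  by rewrite E inE.
case: (eqVneq W' (W `&` W')%fset) => [E|neq'].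
  exfalso; move/eqP: neq; apply; apply/eqP; rewrite eqEfsubset WW' andbT.
  by rewrite fsubUset fsub1set vW E fsubsetIl.
have [u' [v' [h1 h2 h3 h4]]] := IH _ (fsubsetIr _ _) neq' (ex_intro _ y yW).
exists u', v'; move: h1 h3; rewrite !inE h2 orbT andbT => /andP[-> _] h3.
by [].
Qed.

Section Enumeration.
Variable o : V.

(** The list is its own queue: a stage appends the unseen neighbours of one entry, and earlier
    entries never move. *)
Fixpoint bfs n : seq V :=
  if n is n'.+1 then
    bfs n' ++ [seq y <- nb (nth o (bfs n') n') | y \notin bfs n']
  else [:: o].

Lemma bfs_prefix m n : (m <= n)%N -> exists s, bfs n = bfs m ++ s.
Proof.
move=> /subnKC <-; elim: (n - m)%N => [|j [s js]].
  by exists [::]; rewrite addn0 cats0.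
by rewrite addnS /= js -catA; eexists.
Qed.

Lemma nth_bfs m n i : (m <= n)%N -> (i < size (bfs m))%N ->
  nth o (bfs n) i = nth o (bfs m) i.
Proof. by move=> /bfs_prefix[s ->] im; rewrite nth_cat im. Qed.

Lemma bfs_uniq n : uniq (bfs n).
Proof.
elim: n => // n IH /=; rewrite cat_uniq IH filter_uniq ?fset_uniq// andbT/=.
by rewrite -all_predC; apply/allP => y; rewrite mem_filter => /andP[].
Qed.

Lemma bfs_nb n i y : (i < n)%N -> y \in nb (nth o (bfs i) i) -> y \in bfs n.
Proof.
move=> /bfs_prefix[s ->]; rewrite mem_cat /= mem_cat mem_filter => ->.
by rewrite andbT orbN.
Qed.

Lemma nb_closed (A : set V) : A o -> (forall x y, A x -> y \in nb x -> A y) ->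
  forall x, A x.
Proof.
move=> Ao An x; have [p [+ <-]] := cayley_connected hV o x.
elim: p o Ao => //= y p IH z Az /andP[zy yp]; apply: IH => //.
exact: An Az zy.
Qed.

(** If the queue ran out, its finite set of vertices would be closed under neighbours, hence all of
    [V] by connectedness. *)
Lemma size_bfs n : (n < size (bfs n))%N.
Proof.
elim/ltn_ind: n => -[//|n] IHs; have IH := IHs n (ltnSn n).
rewrite ltnNge; apply/negP => small.
have sz : size (bfs n) = n.+1.
  by apply/eqP; rewrite eqn_leq IH andbT (leq_trans _ small)//= size_cat leq_addr.
have same : bfs n.+1 = bfs n.
  have [s sE] := bfs_prefix (leqnSn n); move: small; rewrite sE size_cat sz.
  by rewrite -[X in (_ <= X)%N]addn0 leq_add2l leqn0 => /nilP ->; rewrite cats0.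
apply: (cayley_infinite hV); apply/finite_seqP; exists (bfs n).
apply/seteqP; split=> // x _ /=.
apply: (@nb_closed [set y | y \in bfs n]) => {x} [|x y /=].
  by have [s ->] := bfs_prefix (leq0n n); rewrite /= mem_head.
move=> /(nthP o)[i]; rewrite sz ltnS => ile <- yx; rewrite -same.
apply: (@bfs_nb _ i) => //; rewrite -(nth_bfs ile)//.
exact: IHs.
Qed.

Lemma bfs_parent n j : (0 < j < size (bfs n))%N ->
  exists2 i, (i < j)%N & nth o (bfs n) j \in nb (nth o (bfs n) i).
Proof.
elim: n => [|n IH]; first by case: j => [|[]].
move=> /andP[j0 js].
have [s sE] := bfs_prefix (leqnSn n).
case: (ltnP j (size (bfs n))) => jn.
  have [|i ij ji] := IH; first by rewrite j0.
  by exists i => //; rewrite !(nth_bfs (leqnSn n))// (ltn_trans ij).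
exists n; first exact: leq_trans (size_bfs n) jn.
rewrite (nth_bfs (leqnSn n) (size_bfs n)) /= nth_cat ltnNge jn/=.
set t := [seq y <- _ | _]; have : nth o t (j - size (bfs n)) \in t.
  rewrite mem_nth// ltn_subLR//.
  by move: js; rewrite /= size_cat.
by rewrite mem_filter => /andP[].
Qed.
End Enumeration.

Lemma tree_enumeration : exists (v : nat -> V) (idx : V -> nat),
  [/\ cancel idx v, cancel v idx &
      forall j, (0 < j)%N -> exists2 i, (i < j)%N & v j \in nb (v i)].
Proof.
have [r _] : [set: V] !=set0.
  by apply/set0P/negP => /eqP E; have := cayley_infinite hV; rewrite E.
pose v n := nth r (bfs r n) n.
have vE m i : (i <= m)%N -> v i = nth r (bfs r m) i.
  by move=> im; rewrite (nth_bfs im)// size_bfs.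
have v_bfs n i : (i < size (bfs r n))%N -> v i = nth r (bfs r n) i.
  move=> is_; case: (leqP i n) => [/vE//|/ltnW ni].
  by rewrite /v (nth_bfs ni).
have v_inj : injective v.
  move=> i j; wlog ij : i j / (i <= j)%N => [W|].
    by case/orP: (leq_total i j) => h e; [|symmetry]; exact: W.
  rewrite (vE j i)// (vE j j)// => /eqP; rewrite nth_uniq ?bfs_uniq ?size_bfs//.
    by move=> /eqP.
  exact: leq_ltn_trans ij (size_bfs r j).
have v_surj x : exists n, v n = x.
  apply: (@nb_closed r [set x | exists n, v n = x]) => {x} [|_ y [n <-] yn].
    by exists 0%N.
  have : y \in bfs r n.+1 by apply: (@bfs_nb r n.+1 n).
  by move=> /(nthP r)[j js <-]; exists j; exact: v_bfs.
have /choice[idx idxK] := v_surj.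
exists v, idx; split=> // [n|j j0]; first by apply: v_inj; rewrite idxK.
have [|i ij ji] := @bfs_parent r j j; first by rewrite j0 size_bfs.
by exists i => //; rewrite (vE j j)// (vE j i)// ltnW.
Qed.

Definition prefix_fset (v : nat -> V) n : {fset V} := [fset v i | i in iota 0 n]%fset.

Lemma in_prefix_fset (v : nat -> V) (idx : V -> nat) n x : cancel idx v -> cancel v idx ->
  (x \in prefix_fset v n) = (idx x < n)%N.
Proof.
move=> idxK vK; apply/imfsetP/idP => /= [[i]|xn].
  by rewrite mem_iota /= => iN ->; rewrite vK.
by exists (idx x); rewrite ?mem_iota ?idxK.
Qed.

Lemma prefix_fsetS (v : nat -> V) (idx : V -> nat) n : cancel idx v -> cancel v idx ->
  prefix_fset v n.+1 = (v n |` prefix_fset v n)%fset.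
Proof.
move=> idxK vK; have in_pre := in_prefix_fset _ _ idxK vK.
apply/fsetP => x; rewrite in_pre !inE in_pre ltnS leq_eqVlt.
by congr (_ || _); apply/eqP/eqP => [<-|->]; rewrite ?idxK ?vK.
Qed.

Lemma subtree_prefix (v : nat -> V) (idx : V -> nat) n : cancel idx v -> cancel v idx ->
    (forall j, (0 < j)%N -> exists2 i, (i < j)%N & v j \in nb (v i)) ->
  subtree (prefix_fset v n.+1).
Proof.
move=> idxK vK vnb.
have in_pre := in_prefix_fset _ _ idxK vK.
have preS := prefix_fsetS _ idxK vK.
elim: n => [|n IH].
  rewrite preS (_ : prefix_fset v 0 = fset0) ?fsetU0; first exact: subtree1.
  by apply/fsetP => x; rewrite in_pre !inE.
have [i ij vi] := vnb n.+1 isT.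
by rewrite preS; apply: subtreeU IH _ _ vi; rewrite in_pre vK// ltnn.
Qed.
End Subtrees.
Arguments subtree {V} nb _.

(** * Finite-volume marginals of the Markov chain *)

Section TreeLaw.
Context {R : realType} {d k : nat} {V : choiceType} {nb : V -> {fset V}}.
Hypothesis hV : is_cayley_tree d nb.
Local Notation S := 'rV[int]_k.
Variables (Q x : S -> R) (D c : R).
Hypotheses (Qpos : forall i, 0 < Q i) (Qeven : forall i, Q (- i) = Q i)
  (xpos : forall i, 0 < x i) (D0 : 0 < D) (c0 : 0 < c).
Hypothesis xlaw : forall i,
  (\esum_(j in setT) (Q (i - j) * x j ^+ d)%:E)%E = (D * x i)%:E.
Hypothesis xnorm : (\esum_(j in setT) (x j ^+ d.+1)%:E)%E = (c^-1)%:E.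
Implicit Types (W : {fset V}) (w : V -> S).

Definition upd w v a : V -> S := fun y => if y == v then a else w y.

(** For an edge leaving [W], [x (w u)] is the sum over the whole branch behind it, up to powers of
    [D]. Each of the [#|W| - 1] inner edges of a subtree costs one factor [D^-1], whence the
    prefactor of [tree_law]. *)
Definition site_factor W w u v : R :=
  if v \in W then Num.sqrt (Q (w u - w v)) else x (w u).

(* Each inner edge is traversed in both directions, hence the square root. *)
Definition tree_law W w : R :=
  c * D * D^-1 ^+ #|` W| * \prod_(u <- W) \prod_(v <- nb u) site_factor W w u v.

Lemma site_factor_gt0 W w u v : 0 < site_factor W w u v.
Proof. by rewrite /site_factor; case: ifP; rewrite ?sqrtr_gt0. Qed.

Lemma tree_law_gt0 W w : 0 < tree_law W w.
Proof.
rewrite !mulr_gt0// ?exprn_gt0 ?invr_gt0//.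
by do 2![apply: prodr_gt0 => ? _]; exact: site_factor_gt0.
Qed.

Lemma eq_tree_law W w w' : (forall y, y \in W -> w y = w' y) ->
  tree_law W w = tree_law W w'.
Proof.
move=> ww'; congr (_ * _); rewrite big_seq [RHS]big_seq.
apply: eq_bigr => u uW; apply: eq_bigr => v _; rewrite /site_factor.
by case: ifP => [vW|_]; rewrite !ww'.
Qed.

Lemma tree_law1 v w : tree_law [fset v]%fset w = c * x (w v) ^+ d.+1.
Proof.
rewrite /tree_law cardfs1 expr1 big_seq_fset1 mulfK ?gt_eqF//.
congr (_ * _); rewrite -(cayley_degree hV v).
rewrite (eq_big_seq (fun=> x (w v))); first by rewrite big_const_seq count_predT iter_mulr_1.
move=> y yv; rewrite /site_factor inE; case: eqVneq => // E.
by rewrite E (nb_irr hV) in yv.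
Qed.

(** Attaching [v] affects two vertices. At [u] one outer factor [x (w u)] becomes a square root; at
    [v] there are the matching square root and [d] outer edges, since by [subtree_nb_uniq] no other
    neighbour of [v] lies in [W]. *)
Lemma tree_law_leaf W u v w a : subtree nb W -> u \in W -> v \notin W ->
    v \in nb u ->
  tree_law (v |` W)%fset (upd w v a) =
  tree_law W w / (D * x (w u)) * (Q (w u - a) * x a ^+ d).
Proof.
move=> tW uW vW vu.
have uv : u != v by apply: contraNneq vW => <-.
have updv : upd w v a v = a by rewrite /upd eqxx.
have updW y : y \in W -> upd w v a y = w y.
  by move=> yW; rewrite /upd; case: eqVneq => // E; rewrite -E yW in vW.
have uv' : u \in nb v by rewrite (nb_sym hV).
have vE : \prod_(y <- nb v) site_factor (v |` W)%fset (upd w v a) v y =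
    Num.sqrt (Q (w u - a)) * x a ^+ d.
  rewrite (big_fsetD1 u uv') /= {1}/site_factor !inE uW orbT updv updW//.
  rewrite -[a - _]opprB Qeven; congr (_ * _).
  rewrite (eq_big_seq (fun=> x a)).
    rewrite big_const_seq count_predT iter_mulr_1; congr (_ ^+ _).
    by have := cardfsD1 u (nb v); rewrite uv' (cayley_degree hV) add1n => -[->].
  move=> y; rewrite !inE => /andP[yu yv]; rewrite /site_factor updv !inE.
  case: eqVneq => [E|_] /=; first by rewrite E (nb_irr hV) in yv.
  case: ifP => // yW; have := subtree_nb_uniq hV tW vW yW uW _ vu.
  by rewrite (nb_sym hV) => /(_ yv) /eqP; rewrite (negPf yu).
have uE : \prod_(y <- nb u) site_factor (v |` W)%fset (upd w v a) u y =
    \prod_(y <- nb u) site_factor W w u y * Num.sqrt (Q (w u - a)) / x (w u).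
  rewrite (big_fsetD1 v vu) [in RHS](big_fsetD1 v vu) /=.
  rewrite {1 3}/site_factor !inE eqxx (negPf vW) /= updv updW//.
  rewrite [RHS]mulrAC [x _ * _]mulrC mulfK ?gt_eqF// [LHS]mulrC; congr (_ * _).
  apply: eq_big_seq => y; rewrite !inE => /andP[yv yu].
  rewrite /site_factor !inE (negPf yv) /=; case: ifP => yW; rewrite !updW//.
have othE : \prod_(y <- (W `\ u)%fset) \prod_(z <- nb y)
     site_factor (v |` W)%fset (upd w v a) y z =
   \prod_(y <- (W `\ u)%fset) \prod_(z <- nb y) site_factor W w y z.
  apply: eq_big_seq => y; rewrite !inE => /andP[yu yW].
  apply: eq_big_seq => z zy; rewrite /site_factor !inE.
  have -> /= : (z == v) = false.
    apply/negP => /eqP E; rewrite E in zy.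
    by move: yu; rewrite (subtree_nb_uniq hV tW vW yW uW zy vu) eqxx.
  by case: ifP => zW; rewrite !updW.
rewrite /tree_law cardfsU1 vW add1n exprS.
rewrite big_fsetU1//= vE (big_fsetD1 u uW) [in RHS](big_fsetD1 u uW) /= uE othE.
rewrite -[in RHS](sqr_sqrtr (ltW (Qpos (w u - a)))).
by field; rewrite !gt_eqF.
Qed.

(** Consistency in one leaf is the boundary law equation [xlaw]: its right-hand side cancels the
    denominator [D * x (w u)]. *)
Lemma tree_law_sum W u v w : subtree nb W -> u \in W -> v \notin W ->
    v \in nb u ->
  (\esum_(a in setT) (tree_law (v |` W)%fset (upd w v a))%:E)%E = (tree_law W w)%:E.
Proof.
move=> tW uW vW vu.
under eq_esum do rewrite (tree_law_leaf _ _ tW uW vW vu) EFinM.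
have Dx : 0 < D * x (w u) by rewrite mulr_gt0.
rewrite esumZl.
- by rewrite xlaw -EFinM mulfVK// gt_eqF.
- by rewrite divr_ge0 ?ltW// tree_law_gt0.
- by move=> i; rewrite lee_fin mulr_ge0 ?exprn_ge0// ltW.
Qed.

Lemma tree_law1_sum v w :
  (\esum_(a in setT) (tree_law [fset v]%fset (upd w v a))%:E)%E = 1%E.
Proof.
under eq_esum do rewrite tree_law1 /upd eqxx EFinM.
rewrite esumZl ?(ltW c0)//; last by move=> i; rewrite lee_fin exprn_ge0// ltW.
by rewrite xnorm -EFinM mulfV// gt_eqF.
Qed.
End TreeLaw.
Arguments tree_law {R k V} nb Q x D c W w.

(** * Measures on configurations *)

Lemma measure_esum (R : realType) dd (T : measurableType dd) (S : countType)
    (mu : {measure set T -> \bar R}) (F : S -> set T) :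
    (forall i, measurable (F i)) -> (forall i j t, F i t -> F j t -> i = j) ->
  mu (\bigcup_i F i) = (\esum_(i in setT) mu (F i))%E.
Proof.
move=> mF tF; rewrite esum_countE//.
pose E n := oapp F set0 (pickle_inv n).
have -> : \bigcup_i F i = \bigcup_n E n.
  apply/seteqP; split => t [].
    by move=> i _ Fi; exists (choice.pickle i); rewrite // /E pickleK_inv.
  by move=> n _; rewrite /E; case: pickle_inv => //= i Fi; exists i.
have mE n : measurable (E n) by rewrite /E; case: pickle_inv => /=.
rewrite measure_semi_bigcup//; last by apply: bigcupT_measurable.
- by apply: eq_eseriesr => n _; rewrite /E; case: pickle_inv => /=; rewrite ?measure0.
- move=> m n _ _ [t []]; rewrite /E.
  have := pickle_invK (T := S) m; have := pickle_invK (T := S) n.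
  case: pickle_inv => //= i <-; case: pickle_inv => //= j <-.
  by move=> h1 h2; rewrite (tF _ _ _ h1 h2).
Qed.

Section Conf.
Context {V : choiceType} {k : nat}.
Local Notation S := 'rV[int]_k.
Implicit Types (W : {fset V}) (w s : V -> S).

Definition cyl W w : set (conf V k) := [set s | forall y, y \in W -> s y = w y].

Lemma measurable_coord (y : V) (B : set S) :
  measurable ([set s : conf V k | B (s y)]).
Proof. by apply: sub_sigma_algebra; exists y, B. Qed.

Lemma measurable_cyl W w : measurable (cyl W w).
Proof.
rewrite (_ : cyl W w = \bigcap_(y in [set` W]) [set s : conf V k | [set w y] (s y)]).
  by apply: fin_bigcap_measurable => // y _; exact: measurable_coord.
by apply/seteqP; split => s /= h y; exact: h.
Qed.

Lemma cyl_splitE W v w : v \notin W ->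
  cyl W w = \bigcup_(a : S) cyl (v |` W)%fset (upd w v a).
Proof.
move=> vW; apply/seteqP; split => s /= => [h|[a _ h] y yW].
  exists (s v) => // y; rewrite !inE /upd; case: eqVneq => [->//|_] /=.
  exact: h.
rewrite h ?inE ?yW ?orbT// /upd; case: eqVneq => // E.
by rewrite -E yW in vW.
Qed.

Lemma measure_cyl_split (R : realType) (mu : {measure set (conf V k) -> \bar R})
    W v w : v \notin W ->
  mu (cyl W w) = (\esum_(a in setT) mu (cyl (v |` W)%fset (upd w v a)))%E.
Proof.
move=> vW; rewrite (cyl_splitE w vW) measure_esum//.
  by move=> a; exact: measurable_cyl.
move=> a b s ha hb; have vvW : v \in (v |` W)%fset by rewrite !inE eqxx.
by have := ha v vvW; rewrite (hb v vvW) /upd eqxx.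
Qed.

Section Unique.
Variables (e : nat -> V) (idx : V -> nat).
Hypotheses (idxK : cancel idx e) (eK : cancel e idx).
Local Notation pre := (prefix_fset e).

Let in_pre n y : (y \in pre n) = (idx y < n)%N.
Proof. exact: in_prefix_fset. Qed.

Definition word_conf (u : seq S) : V -> S := fun y => nth 0 u (idx y).

Definition prefix_word w n : seq S := mkseq (fun i => w (e i)) n.

Lemma word_confK w n y : y \in pre n -> word_conf (prefix_word w n) y = w y.
Proof. by rewrite in_pre => yn; rewrite /word_conf nth_mkseq// idxK. Qed.

Lemma cyl_prefixE n w : cyl (pre n) w = [set s | prefix_word s n = prefix_word w n].
Proof.
apply/seteqP; split => s /=.
  move=> h; apply/eq_in_map => i; rewrite mem_iota => /andP[_ iN].
  by apply: h; rewrite in_pre eK.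
by move=> h y yn; rewrite -(word_confK s yn) h word_confK.
Qed.

(** A coordinate can be read from any longer initial segment. Short segments are excluded because
    the Gibbs kernel is computed only when [Lam] and its neighbours lie inside. *)
Lemma conf_measurable_gen N :
  @measurable _ (conf V k) =
  <<s [set A | A = set0 \/ A = setT \/ exists n w, (N <= n)%N /\ A = cyl (pre n) w] >>.
Proof.
set G := [set A | _]; apply/seteqP; split; last first.
  apply: smallest_sub; first exact: sigma_algebra_measurable.
  move=> A [->|[->|[n [w [_ ->]]]]] //; exact: measurable_cyl.
apply: smallest_sub; first exact: smallest_sigma_algebra.
move=> _ [y [B ->]].
pose n := maxn N (idx y).+1.
have yn : y \in pre n by rewrite in_pre leq_max ltnSn orbT.
have -> : [set s : conf V k | B (s y)] =
    \bigcup_(u : seq S) (if word_conf u y \in B then cyl (pre n) (word_conf u) else set0).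
  apply/seteqP; split => s /=.
    move=> Bs; exists (prefix_word s n) => //.
    rewrite word_confK// mem_set// => z zn; by rewrite word_confK.
  by move=> [u _]; case: ifPn => // /set_mem Bu; rewrite /cyl /= => ->.
apply: (@countable_bigcupT_measurable _ (g_sigma_algebraType G)) => // u.
apply: sub_sigma_algebra; rewrite /G /=; case: ifP => _; last by left.
by right; right; exists n, (word_conf u); rewrite leq_maxl.
Qed.

(** Cylinders over two initial segments are nested or disjoint, so together with [set0] and [setT]
    they form a pi-system. *)
Lemma conf_measure_ext (R : realType) (m1 m2 : {measure set (conf V k) -> \bar R}) N :
    m1 setT = m2 setT -> (m1 setT < +oo)%E ->
    (forall n w, (N <= n)%N -> m1 (cyl (pre n) w) = m2 (cyl (pre n) w)) ->
  forall A, measurable A -> m1 A = m2 A.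
Proof.
move=> mT mfin m12 A mA.
apply: (measure_unique _ (fun=> setT) (conf_measurable_gen N)) => //.
- move=> _ _ [->|[->|[m [w [Nm ->]]]]] [->|[->|[n [w' [Nn ->]]]]];
    rewrite ?set0I ?setI0 ?setIT ?setTI; try by left.
  + by right; left.
  + by right; right; exists n, w'.
  + by right; right; exists m, w.
  + wlog mn : m n w w' Nm Nn / (m <= n)%N => [W|].
      by case/orP: (leq_total m n) => h; [|rewrite setIC]; exact: W.
    case: (pselect (forall y, y \in pre m -> w y = w' y)) => [ww'|nww'].
      right; right; exists n, w'; split => //; apply/seteqP; split => s /=.
        by case.
      move=> h; split => // y ym; rewrite h ?ww'//.
      by move: ym; rewrite !in_pre => /leq_trans; apply.
    left; apply/seteqP; split => // s [h1 h2]; apply: nww' => y ym.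
    rewrite -h1// h2//.
    by move: ym; rewrite !in_pre => /leq_trans; apply.
- by move=> n; right; left.
- by rewrite bigcup_const.
- by move=> B [->|[->|[n [w [Nn ->]]]]]; rewrite ?measure0//; exact: m12.
Qed.
End Unique.
End Conf.

(** * Existence of the chain with the prescribed marginals *)

Section TreeMeasure.
Context {R : realType} {d k : nat} {V : choiceType} {nb : V -> {fset V}}.
Hypothesis hV : is_cayley_tree d nb.
Local Notation S := 'rV[int]_k.
Variables (Q x : S -> R) (D c : R).
Hypotheses (Qpos : forall i, 0 < Q i) (Qeven : forall i, Q (- i) = Q i)
  (xpos : forall i, 0 < x i) (D0 : 0 < D) (c0 : 0 < c).
Hypothesis xlaw : forall i,
  (\esum_(j in setT) (Q (i - j) * x j ^+ d)%:E)%E = (D * x i)%:E.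
Hypothesis xnorm : (\esum_(j in setT) (x j ^+ d.+1)%:E)%E = (c^-1)%:E.
Local Notation law := (tree_law nb Q x D c).

Lemma tree_measure_exists : exists mu : probability (conf V k) R,
  forall W, subtree nb W -> forall w, mu (cyl W w) = (law W w)%:E.
Proof.
have [e [idx [idxK eK enb]]] := tree_enumeration hV.
have in_pre n y : (y \in prefix_fset e n) = (idx y < n)%N by exact: in_prefix_fset.
have preS := prefix_fsetS _ idxK eK.
have pre1 : prefix_fset e 1 = [fset e 0]%fset.
  by rewrite preS; apply/fsetP => y; rewrite !inE in_pre orbF.
(* The empty word needs its own value: on [fset0] the formula of [tree_law] gives [c * D], not
   [1]. *)
pose p (u : seq S) : R := if u is [::] then 1 else
  law (prefix_fset e (size u)) (word_conf idx u).
have pE u : (0 < size u)%N -> p u = law (prefix_fset e (size u)) (word_conf idx u).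
  by case: u.
have p0 u : 0 <= p u.
  by case: u => //= a u; rewrite ltW// tree_law_gt0.
have word_rcons u a : word_conf idx (rcons u a) = upd (word_conf idx u) (e (size u)) a.
  apply/funext => y; rewrite /word_conf /upd nth_rcons.
  have -> : (y == e (size u)) = (idx y == size u).
    by apply/eqP/eqP => [->|<-]; rewrite ?eK ?idxK.
  by case: ltngtP => // h; rewrite nth_default// ltnW.
have pS u : (\esum_(a in setT) (p (rcons u a))%:E)%E = (p u)%:E.
  under eq_esum do rewrite pE ?size_rcons// word_rcons.
  case: u => [|b u].
    by rewrite /= pre1; exact: (tree_law1_sum hV Q xpos D0 c0 xnorm).
  have [i ij ji] := enb (size u).+1 isT.
  have tW := subtree_prefix (size u) idxK eK enb.
  rewrite /= preS; apply: (tree_law_sum hV Qpos Qeven xpos D0 c0 xlaw _ tW _ _ ji).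
    by rewrite in_pre eK.
  by rewrite in_pre eK ltnn.
have [P [X [mX PX]]] := word_measure (0 : S) p0 erefl pS.
pose sigma (t : measurableTypeR R) : conf V k := fun y => X (idx y) t.
have msigma : measurable_fun setT sigma.
  apply: (@measurability _ _ (measurableTypeR R) (conf V k) setT sigma
    (@cylinders V k) erefl) => _ [_ [y [B ->]] <-].
  rewrite setTI (_ : _ @^-1` _ =
      \bigcup_(a : S) (if a \in B then X (idx y) @^-1` [set a] else set0)).
    by apply: countable_bigcupT_measurable => // a; case: ifP.
  apply/seteqP; split => t /=.
    by move=> Bt; exists (X (idx y) t) => //; rewrite mem_set.
  by move=> [a _]; case: ifPn => // /set_mem Ba; rewrite /sigma /= => ->.
have msig : sigma \in mfun by rewrite inE; exact: msigma.
pose mu : probability (conf V k) R := distribution P (mfun_Sub msig).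
have mu_pre n w : mu (cyl (prefix_fset e n.+1) w) = (law (prefix_fset e n.+1) w)%:E.
  rewrite (cyl_prefixE idxK eK) /mu /distribution /pushforward.
  have := PX (prefix_word e w n.+1); rewrite size_mkseq pE ?size_mkseq// => PE.
  have <- : law (prefix_fset e n.+1) (word_conf idx (prefix_word e w n.+1)) =
            law (prefix_fset e n.+1) w.
    by apply: eq_tree_law => y yn; rewrite (word_confK idxK eK).
  rewrite -PE; congr (P _); apply/seteqP; split => t /=; rewrite /prefix_word /sigma.
    by move=> <-; apply: eq_mkseq => i; rewrite eK.
  by move=> <-; apply: eq_mkseq => i; rewrite eK.
exists mu => W tW.
have [N WN] : exists N, (W `<=` prefix_fset e N.+1)%fset.
  exists (\max_(y <- W) idx y)%N; apply/fsubsetP => y yW.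
  by rewrite in_pre ltnS; apply: leq_bigmax_seq.
have tN := subtree_prefix N idxK eK enb.
(* Initial segments are settled. For a smaller subtree, both the measure of the cylinder and the law
   are sums over the spin of one added vertex, so induction runs on the number of missing
   vertices. *)
have [m] := ubnP #|` (prefix_fset e N.+1 `\` W)%fset|; elim: m => // m IH in W tW WN *.
rewrite ltnS => Wm w.
case: (eqVneq (prefix_fset e N.+1) W) => [<-//|neq].
have [u [v [uW vN vW vu]]] := subtree_grow hV tN WN neq (subtree_neq0 tW).
rewrite (measure_cyl_split _ _ vW).
rewrite -(tree_law_sum hV Qpos Qeven xpos D0 c0 xlaw w tW uW vW vu).
apply: eq_esum => a _; apply: IH.
- exact: subtreeU vu.
- by rewrite fsubUset fsub1set vN.
- apply: leq_trans Wm; rewrite [leqRHS](cardfsD1 v) inE vW vN add1n ltnS.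
  apply: fsubset_leq_card; apply/fsubsetP => y.
  by rewrite !inE negb_or -andbA.
Qed.
End TreeMeasure.

(** * Gibbsian weights of the marginals *)

Lemma prod_pred1_seq (R : comPzSemiRingType) (T : eqType) (r : seq T) (q : T)
    (P : pred T) (F : T -> R) : uniq r -> q \in r ->
    (forall v, v \in r -> P v = (v == q)) ->
  \prod_(v <- r | P v) F v = F q.
Proof.
move=> ur qr Pq; rewrite big_mkcond (bigD1_seq q)//= Pq// eqxx.
rewrite big1_seq ?mulr1// => v /andP[vq vr].
by rewrite Pq// (negPf vq).
Qed.

Lemma eq_fset2 (T : choiceType) (p q v : T) : p != q ->
  ([fset p; v]%fset == [fset p; q]%fset) = (v == q).
Proof.
move=> pq; apply/eqP/eqP => [/fsetP/(_ q)|->//].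
by rewrite !inE eqxx orbT eq_sym (negPf pq) eq_sym => /eqP.
Qed.

Section Weight.
Context {R : realType} {d k : nat} {V : choiceType} {nb : V -> {fset V}}.
Hypothesis hV : is_cayley_tree d nb.
Local Notation S := 'rV[int]_k.
Variables (Q x : S -> R) (D c : R).
Hypotheses (Qpos : forall i, 0 < Q i) (Qeven : forall i, Q (- i) = Q i).
Local Notation law := (tree_law nb Q x D c).
Variables (Lam W : {fset V}).
Hypothesis Lam_sub : forall u, u \in Lam -> u \in W /\ {subset nb u <= W}.
Implicit Types s w : V -> S.

Let touch u v := (u \in Lam) || (v \in Lam).
Let f s u v := Num.sqrt (Q (s u - s v)).

Let touch_W u v : v \in nb u -> touch u v -> u \in W /\ v \in W.
Proof.
move=> vu /orP[/Lam_sub[h1 h2]|/Lam_sub[h1 h2]]; split=> //; apply: h2 => //.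
by rewrite (nb_sym hV).
Qed.

Let edgesP b : reflect (exists p q, [/\ p \in Lam, q \in nb p & b = [fset p; q]%fset])
  (b \in edges_meeting nb Lam).
Proof.
apply: (iffP (imfset2P _ _ _ _ _)) => /= [[p pL [q qp ->]]|[p [q [pL qp ->]]]].
  by exists p, q.
by exists p => //; exists q.
Qed.

Let edges_touch u v : v \in nb u ->
  ([fset u; v]%fset \in edges_meeting nb Lam) = touch u v.
Proof.
move=> vu; apply/edgesP/orP => [[p [q [pL qp E]]]|[uL|vL]]; last 2 first.
- by exists u, v.
- by exists v, u; rewrite vL (nb_sym hV) vu fsetUC.
have : p \in [fset u; v]%fset by rewrite E !inE eqxx.
by rewrite !inE => /orP[] /eqP <-; [left|right].
Qed.

Let edge_weight_prod s b : b \in edges_meeting nb Lam ->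
  edge_weight Q s b =
  \prod_(u <- W) \prod_(v <- nb u | [fset u; v]%fset == b) f s u v.
Proof.
move=> /edgesP[p [q [pL qp ->]]].
have pq : p != q by apply: contraTneq qp => ->; rewrite (nb_irr hV).
have [pW /(_ _ qp) qW] := Lam_sub pL.
have qWp : q \in (W `\ p)%fset by rewrite !inE eq_sym pq.
rewrite edge_weightE// (big_fsetD1 p pW)/= (big_fsetD1 q qWp)/=.
rewrite (prod_pred1_seq _ (fset_uniq _) qp) => [|v _]; last exact: eq_fset2.
rewrite (@prod_pred1_seq _ _ _ p) ?fset_uniq// => [||v _]; last 2 first.
- by rewrite (nb_sym hV).
- by rewrite [X in _ == X]fsetUC eq_fset2 // eq_sym.
rewrite big1_seq ?mulr1 => [|u /andP[_]]; last first.
  rewrite !inE => /and3P[uq up _]; apply: big1_seq => v /andP[/eqP E _].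
  have : u \in [fset p; q]%fset by rewrite -E !inE eqxx.
  by rewrite !inE (negPf uq) (negPf up).
by rewrite /f -[s q - s p]opprB Qeven -expr2 sqr_sqrtr// ltW.
Qed.

(** Each unoriented edge is met by two ordered pairs, each contributing a square root; this puts the
    Gibbs weight in the shape of [tree_law]. *)
Lemma weightE s :
  weight nb Q Lam s = \prod_(u <- W) \prod_(v <- nb u | touch u v) f s u v.
Proof.
rewrite /weight big_seq (eq_bigr _ (fun b => @edge_weight_prod s b)) -big_seq.
rewrite exchange_big/=; apply: eq_bigr => u _.
rewrite (exchange_big_dep xpredT)//= [RHS]big_mkcond/=; apply: eq_big_seq => v vu.
rewrite -edges_touch//; case: ifPn => bE.
  apply: (@prod_pred1_seq _ _ _ [fset u; v]%fset) => [||b _]; rewrite ?fset_uniq//.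
rewrite big_seq_cond big1// => b /andP[bE' /eqP E].
by rewrite E bE' in bE.
Qed.

Lemma weight_gt0 s : 0 < weight nb Q Lam s.
Proof.
by rewrite weightE; do 2![apply: prodr_gt0 => ? _]; rewrite sqrtr_gt0.
Qed.

Lemma eq_weight s s' : (forall y, y \in W -> s y = s' y) ->
  weight nb Q Lam s = weight nb Q Lam s'.
Proof.
move=> ss'; rewrite !weightE; apply: eq_bigr => u _.
rewrite big_seq_cond [RHS]big_seq_cond; apply: eq_bigr => v /andP[vu uv].
by have [uW vW] := touch_W vu uv; rewrite /f !ss'.
Qed.

(** The factors meeting [Lam] are exactly those of [weightE] and cancel; the remaining ones see no
    spin of [Lam]. *)
Lemma tree_law_weight s s' : (forall y, y \notin Lam -> s y = s' y) ->
  law W s / weight nb Q Lam s = law W s' / weight nb Q Lam s'.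
Proof.
move=> ss'.
have lawE t : law W t = c * D * D^-1 ^+ #|` W| * (weight nb Q Lam t *
    \prod_(u <- W) \prod_(v <- nb u | ~~ touch u v) site_factor Q x W t u v).
  rewrite weightE -big_split/=; congr (_ * _); apply: eq_bigr => u _.
  rewrite (bigID (touch u))/=; congr (_ * _).
  rewrite big_seq_cond [RHS]big_seq_cond; apply: eq_bigr => v /andP[vu uv].
  by have [uW vW] := touch_W vu uv; rewrite /site_factor vW.
rewrite !lawE ![weight _ _ _ _ * _]mulrC !mulrA !mulfK ?gt_eqF ?weight_gt0//.
congr (_ * _); apply: eq_bigr => u _; apply: eq_bigr => v.
rewrite negb_or => /andP[uL vL]; rewrite /site_factor.
by case: ifP => _; rewrite !ss'.
Qed.
End Weight.

(** * The Gibbs property *)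

Section Patch.
Context {V : choiceType} {k : nat}.
Local Notation S := 'rV[int]_k.
Variable Lam : {fset V}.
Implicit Types (z : {ffun Lam -> S}) (w s : V -> S).

(** Indexes [agree_off Lam w] by the countable type [{ffun Lam -> S}], so that kernels become
    countable sums. *)
Definition patch z w : V -> S := fun y => if insub y is Some u then z u else w y.

Lemma patch_out z w y : y \notin Lam -> patch z w y = w y.
Proof. by move=> yL; rewrite /patch insubN. Qed.

Lemma patch_in z w w' y : y \in Lam -> patch z w y = patch z w' y.
Proof. by move=> yL; rewrite /patch insubT. Qed.

Lemma patch_inj w : injective (patch^~ w).
Proof.
move=> z z' E; apply/ffunP => u; have := congr1 (@^~ (val u)) E.
by rewrite /patch valK.
Qed.

Lemma agree_offE w : agree_off Lam w = range (patch^~ w).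
Proof.
apply/seteqP; split => s /= => [sw|[z _ <-] y yL]; last exact: patch_out.
exists [ffun u : Lam => s (val u)] => //; apply/funext => y; rewrite /patch.
by case: insubP => [u _ <-|yL]; rewrite ?ffunE// sw.
Qed.

Lemma esum_agree_off (R : realType) (w : V -> S) (A : set (V -> S))
    (g : (V -> S) -> \bar R) :
  (\esum_(s in agree_off Lam w `&` A) g s =
   \esum_(z in setT) if patch z w \in A then g (patch z w) else 0)%E.
Proof.
rewrite esum_mkcondr agree_offE esum_image// => z z' _ _; exact: patch_inj.
Qed.

Lemma measurable_patch z : measurable_fun setT (patch z : conf V k -> conf V k).
Proof.
apply: (@measurability _ _ (conf V k) (conf V k) setT (patch z) (@cylinders V k) erefl).
move=> _ [_ [y [B ->]] <-]; rewrite setTI.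
case: (boolP (y \in Lam)) => yL; last first.
  rewrite (_ : _ @^-1` _ = [set s : conf V k | B (s y)]); first exact: measurable_coord.
  by apply/seteqP; split => s /=; rewrite patch_out.
case: (pselect (B (patch z (fun=> 0) y))) => By.
  rewrite (_ : _ @^-1` _ = setT)//; apply/seteqP; split => s //= _.
  by rewrite (patch_in _ _ (fun=> 0)).
rewrite (_ : _ @^-1` _ = set0)//; apply/seteqP; split => s //=.
by rewrite (patch_in _ _ (fun=> 0)).
Qed.
End Patch.

Section Gibbs.
Context {R : realType} {d k : nat} {V : choiceType} {nb : V -> {fset V}}.
Hypothesis hV : is_cayley_tree d nb.
Local Notation S := 'rV[int]_k.
Variables (Q x : S -> R) (D c : R).
Hypotheses (Qpos : forall i, 0 < Q i) (Qeven : forall i, Q (- i) = Q i)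
  (xpos : forall i, 0 < x i) (D0 : 0 < D) (c0 : 0 < c).
Local Notation law := (tree_law nb Q x D c).
Variable mu : probability (conf V k) R.
Hypothesis muE : forall W, subtree nb W -> forall w, mu (cyl W w) = (law W w)%:E.
Variables (e : nat -> V) (idx : V -> nat).
Hypotheses (idxK : cancel idx e) (eK : cancel e idx)
  (enb : forall j, (0 < j)%N -> exists2 i, (i < j)%N & e j \in nb (e i)).
Local Notation pre := (prefix_fset e).

Let in_pre n y : (y \in pre n) = (idx y < n)%N.
Proof. exact: in_prefix_fset. Qed.

Lemma finite_coords_measurable dd (T : measurableType dd) (f : conf V k -> T) n :
    (forall s s' : V -> S, (forall y, y \in pre n -> s y = s' y) -> f s = f s') ->
  measurable_fun setT f.
Proof.
move=> fE _ B mB; rewrite setTI.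
have -> : f @^-1` B = \bigcup_(u : seq S)
    (if f (word_conf idx u) \in B then cyl (pre n) (word_conf idx u) else set0).
  apply/seteqP; split => s /=.
    move=> Bs; exists (prefix_word e s n) => //.
    rewrite (_ : f (word_conf _ _) = f s).
      by rewrite mem_set// => y yn; rewrite (word_confK idxK eK).
    by apply: fE => y yn; rewrite (word_confK idxK eK).
  by move=> [u _]; case: ifPn => // /set_mem Bu /fE; rewrite /preimage /= => ->.
apply: countable_bigcupT_measurable => // u; case: ifP => // _.
exact: measurable_cyl.
Qed.

Variable Lam : {fset V}.
Local Notation wt := (weight nb Q Lam).
Local Notation Z := (partition_function nb Q Lam).
Local Notation spec := (specification nb Q Lam).

Let Lam_pre : exists N, forall n, (N < n)%N ->
  forall u, u \in Lam -> u \in pre n /\ {subset nb u <= pre n}.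
Proof.
exists (\max_(u <- Lam) maxn (idx u) (\max_(v <- nb u) idx v))%N => n Nn u uL.
have : (maxn (idx u) (\max_(v <- nb u) idx v) < n)%N.
  apply: leq_ltn_trans Nn.
  exact: (leq_bigmax_seq (F := fun u => maxn (idx u) (\max_(v <- nb u) idx v))).
rewrite gtn_max => /andP[un vn]; split; first by rewrite in_pre.
move=> v vu; rewrite in_pre; apply: leq_ltn_trans vn.
exact: leq_bigmax_seq.
Qed.

Let N := sval (cid Lam_pre).
Let Lam_sub n (Nn : (N < n)%N) :
  forall u, u \in Lam -> u \in pre n /\ {subset nb u <= pre n}.
Proof. by move: n Nn; rewrite /N; case: cid. Qed.

Let N1 : (N < N.+1)%N := ltnSn N.

Let wt_gt0 s : 0 < wt s. Proof. exact: (weight_gt0 hV Qpos Qeven (Lam_sub N1)). Qed.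

Let ZE w : Z w = (\esum_(z in [set: {ffun Lam -> S}]) (wt (patch z w))%:E)%E.
Proof.
rewrite /partition_function -[agree_off _ _]setIT esum_agree_off.
by apply: eq_esum => z _; rewrite in_setT.
Qed.

Let H n w := law (pre n) w / wt w.

Let H_gt0 n w : 0 < H n w.
Proof. by rewrite divr_gt0// tree_law_gt0. Qed.

(** Summing [law = H * wt] over the spins in [Lam], on which [H] does not depend, produces [Z]. As
    the left-hand side is positive and at most [1], the partition function is finite and
    positive. *)
Let mass n w : (N < n)%N ->
  mu (cyl (pre n `\` Lam)%fset w) = ((H n w)%:E * Z w)%E.
Proof.
move=> Nn.
have -> : cyl (pre n `\` Lam)%fset w =
    \bigcup_(z : {ffun Lam -> S}) cyl (pre n) (patch z w).
  apply/seteqP; split => s /= => [sw|[z _ sz] y].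
    have [z _ zE] : range (fun z : {ffun Lam -> S} => patch z s) s.
      by rewrite -(agree_offE Lam).
    exists z => // y yn; case: (boolP (y \in Lam)) => yL.
      by rewrite -[in LHS]zE; exact: patch_in.
    by rewrite patch_out// sw// inE yL.
  by rewrite inE => /andP[yL yn]; rewrite sz// patch_out.
rewrite measure_esum.
- rewrite ZE -esumZl; [|exact: ltW|by move=> z; rewrite lee_fin ltW].
  apply: eq_esum => z _.
  have tn : subtree nb (pre n).
    by case: n Nn => // n _; exact: (subtree_prefix _ idxK eK enb).
  transitivity (law (pre n) (patch z w))%:E; first exact: muE.
  rewrite -EFinM; congr (_%:E).
  rewrite /H (tree_law_weight hV x D c Qpos Qeven (Lam_sub Nn) (s' := patch z w)).
    by rewrite mulfVK// gt_eqF.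
  by move=> y yL; rewrite patch_out.
- by move=> z; exact: measurable_cyl.
- move=> z z' s h h'; apply: (@patch_inj _ _ _ w); apply/funext => y.
  case: (boolP (y \in Lam)) => yL; last by rewrite !patch_out.
  by rewrite -h ?(Lam_sub Nn yL).1// h'// (Lam_sub Nn yL).1.
Qed.

Let zf w := fine (Z w).

Let Z_ge0 w : (0 <= Z w)%E.
Proof. by rewrite ZE esum_ge0// => z _; rewrite lee_fin ltW. Qed.

Let Z_fin w : Z w = (zf w)%:E.
Proof.
rewrite /zf fineK// ge0_fin_numE// ltey; apply/eqP => Zoo.
have := mass w N1; rewrite Zoo gt0_muley ?lte_fin//.
by apply/eqP; rewrite lt_eqF// (le_lt_trans (probability_le1 _ _)) ?ltry//;
  exact: measurable_cyl.
Qed.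

Let zf_gt0 w : 0 < zf w.
Proof.
rewrite lt_neqAle -lee_fin -Z_fin Z_ge0 andbT; apply/eqP => z0.
have := mass w N1; rewrite Z_fin -z0 mule0 => m0.
have : (mu (cyl (pre N.+1) w) <= mu (cyl (pre N.+1 `\` Lam)%fset w))%E.
  apply: le_measure; rewrite ?inE; [exact: measurable_cyl|exact: measurable_cyl|].
  by move=> s h y; rewrite inE => /andP[_ yn]; exact: h.
rewrite m0 muE; last exact: (subtree_prefix _ idxK eK enb).
by rewrite lee_fin leNgt tree_law_gt0.
Qed.

Let K (z : {ffun Lam -> S}) (w : V -> S) := wt (patch z w) / zf w.

Let K_ge0 z w : 0 <= K z w.
Proof. by rewrite divr_ge0// ltW. Qed.

Let specE (A : set (conf V k)) (w : conf V k) :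
  spec A w = (\esum_(z in setT) ((K z w)%:E * (\1_A (patch z w : conf V k))%:E))%E.
Proof.
rewrite /specification esum_agree_off Z_fin inver gt_eqF//.
apply: eq_esum => z _; rewrite indicE /K; case: ifP => _ /=.
  by rewrite mule1 -EFinM.
by rewrite mule0.
Qed.

Let eq_wt n s s' : (N < n)%N -> (forall y, y \in pre n -> s y = s' y) -> wt s = wt s'.
Proof. by move=> Nn; exact: (eq_weight hV Qpos Qeven (Lam_sub Nn)). Qed.

Let eq_patch n (z : {ffun Lam -> S}) s s' :
  (forall y, y \in (pre n `\` Lam)%fset -> s y = s' y) ->
  forall y, y \in pre n -> patch z s y = patch z s' y.
Proof.
move=> ss' y yn; case: (boolP (y \in Lam)) => yL; first exact: patch_in.
by rewrite !patch_out// ss'// inE yL.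
Qed.

Let eq_zf n s s' : (N < n)%N -> (forall y, y \in (pre n `\` Lam)%fset -> s y = s' y) ->
  zf s = zf s'.
Proof.
move=> Nn ss'; rewrite /zf !ZE; congr fine; apply: eq_esum => z _.
by congr (_%:E); apply: (eq_wt Nn); exact: eq_patch.
Qed.

Let spec_term_ge0 A z (w : conf V k) :
  (0 <= (K z w)%:E * (\1_A (patch z w : conf V k))%:E)%E.
Proof. by rewrite mule_ge0// lee_fin. Qed.

Let spec_ge0 A w : (0 <= spec A w)%E.
Proof. by rewrite specE esum_ge0. Qed.

Let measurable_spec (A : set (conf V k)) : measurable A ->
  @measurable_fun _ _ (conf V k) (\bar R) setT (spec A).
Proof.
move=> mA.
have -> : (spec A : conf V k -> \bar R) = (fun w : conf V k => \sum_(n <oo | n \in xpredT)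
    oapp (fun z => (K z w)%:E * (\1_A (patch z w : conf V k))%:E) 0 (pickle_inv n))%E.
  by apply/funext => w; rewrite specE esum_countE.
apply: ge0_emeasurable_sum => [n w _ _|n _].
  by case: pickle_inv => //=.
case: pickle_inv => [z|] /=; last exact: measurable_cst.
apply: emeasurable_funM.
  apply: (@finite_coords_measurable _ _ _ N.+1) => s s' ss'.
  have ss'' y : y \in (pre N.+1 `\` Lam)%fset -> s y = s' y.
    by rewrite inE => /andP[_]; exact: ss'.
  congr (_%:E); rewrite /K (eq_zf N1 ss''); congr (_ / _).
  by apply: (eq_wt N1); exact: eq_patch.
have mP : measurable (patch z @^-1` A : set (conf V k)).
  by rewrite -[X in measurable X]setTI; exact: measurable_patch.
apply/measurable_EFinP.
exact: (@measurable_indic _ (conf V k) R setT _ mP).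
Qed.

(** Once this is known to be a measure, [conf_measure_ext] reduces the Gibbs property to
    cylinders. *)
Definition gibbs_mix (A : set (conf V k)) : \bar R := (\int[mu]_w spec A w)%E.

Let gibbs_mix0 : gibbs_mix set0 = 0%E.
Proof.
rewrite /gibbs_mix (eq_integral (cst 0%E)) ?integral0// => w _ /=.
by rewrite /specification setI0 esum_set0.
Qed.

Let gibbs_mix_ge0 A : (0 <= gibbs_mix A)%E.
Proof. exact: integral_ge0. Qed.

Let gibbs_mix_sigma_additive : semi_sigma_additive gibbs_mix.
Proof.
move=> F mF tF mUF.
have -> : gibbs_mix (\bigcup_n F n) = (\sum_(n <oo) gibbs_mix (F n))%E.
  rewrite /gibbs_mix -integral_nneseries//; last by move=> n; exact: measurable_spec.
  apply: eq_integral => w _; rewrite /specification Z_fin inver gt_eqF//.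
  rewrite setI_bigcupr nneseries_sum_bigcup//.
    by apply: trivIset_setIl.
  by move=> s; rewrite -EFinM lee_fin divr_ge0// ltW.
by apply: is_cvg_ereal_nneg_natsum.
Qed.

HB.instance Definition _ := isMeasure.Build _ _ _ gibbs_mix gibbs_mix0 gibbs_mix_ge0
  gibbs_mix_sigma_additive.

Let gibbs_mixT : gibbs_mix setT = 1%E.
Proof.
rewrite /gibbs_mix (eq_integral (cst 1%E)) => [|w _].
  by rewrite integral_cst// mul1e; exact: probability_setT.
rewrite specE; under eq_esum do rewrite indicT mule1 /K mulrC EFinM.
rewrite esumZl; first by rewrite -ZE Z_fin -EFinM mulVf// gt_eqF.
  by rewrite invr_ge0 ltW.
by move=> z; rewrite lee_fin ltW.
Qed.

Let gibbs_mix_cyl n w : (N < n)%N -> gibbs_mix (cyl (pre n) w) = mu (cyl (pre n) w).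
Proof.
move=> Nn.
have mC : measurable (cyl (pre n `\` Lam)%fset w) by exact: measurable_cyl.
have sE (s : conf V k) : spec (cyl (pre n) w) s =
    ((wt w / zf w)%:E * (\1_(cyl (pre n `\` Lam)%fset w) s)%:E)%E.
  rewrite /specification indicE; case: (boolP (s \in _)) => [/set_mem sw|sw].
    (* [Lam] lies in [pre n], so the cylinder leaves a single configuration: [w] on [Lam] and [s]
       elsewhere. *)
    have -> : agree_off Lam s `&` cyl (pre n) w =
        [set (fun y => if y \in Lam then w y else s y)].
      apply/seteqP; split => [t [h1 h2]|_ ->]; last first.
        split=> [y /negPf ->//|y yn] /=; case: ifPn => // yL.
        by apply: sw; rewrite inE yL.
      apply/funext => y; case: ifPn => yL; last exact: h1.
      by apply: h2; exact: (Lam_sub Nn yL).1.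
    rewrite Z_fin inver gt_eqF// esum_set1 -?EFinM ?lee_fin ?divr_ge0 ?ltW// mulr1.
    rewrite (eq_zf Nn sw); congr (_ * _)%:E; apply: (eq_wt Nn) => y yn.
    by case: ifPn => // yL; apply: sw; rewrite inE yL.
  rewrite (_ : _ `&` _ = set0) ?esum_set0 ?mule0//.
  apply/seteqP; split => // t [/= h1 h2]; move/negP: sw; apply; apply/mem_set => y.
  by rewrite inE => /andP[yL yn]; rewrite -h1// h2.
rewrite /gibbs_mix; under eq_integral do rewrite sE.
rewrite ge0_integralZl_EFin//; last 2 first.
- by apply/measurable_EFinP; exact: measurable_indic.
- by rewrite divr_ge0// ltW.
transitivity ((wt w / zf w)%:E * mu (cyl (pre n `\` Lam)%fset w))%E.
  by congr (_ * _)%E; rewrite integral_indic// setIT.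
rewrite mass// Z_fin -!EFinM /H muE; last first.
  by case: n Nn {mC sE} => // n _; exact: (subtree_prefix _ idxK eK enb).
by congr (_%:E); field; rewrite !gt_eqF.
Qed.

Lemma gibbs_spec A : measurable A -> gibbs_mix A = mu A.
Proof.
apply: (conf_measure_ext idxK eK (N := N.+1)).
- by transitivity (1 : \bar R)%E; [exact: gibbs_mixT|symmetry; exact: probability_setT].
- suff : (gibbs_mix setT < +oo)%E by [].
  by rewrite gibbs_mixT ltry.
- by move=> n w Nn; exact: gibbs_mix_cyl.
Qed.
End Gibbs.

(** * Automorphisms and translations *)

Section Automorphism.
Context {R : realType} {k : nat} {V : choiceType} {nb : V -> {fset V}}.
Local Notation S := 'rV[int]_k.
Variables (g h : V -> V).
Hypotheses (gK : cancel g h) (hK : cancel h g)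
  (g_adj : forall u v, adj nb (g u) (g v) = adj nb u v).

Let g_inj : injective g := can_inj gK.

Lemma nb_image u : nb (g u) = [fset g v | v in nb u]%fset.
Proof.
apply/fsetP => v; apply/idP/imfsetP => /= [vu|[z zu ->]]; last first.
  by have := g_adj u z; rewrite /adj => ->.
by exists (h v); rewrite ?hK//; have := g_adj u (h v); rewrite /adj hK => <-.
Qed.

Lemma subtree_image W : subtree nb W ->
  subtree nb [fset g v | v in W]%fset.
Proof.
elim=> [v|{}W u v tW IH uW vW vu]; first by rewrite imfset_fset1; exact: subtree1.
rewrite imfsetU1; apply: (subtreeU (u := g u)) => //.
- exact: in_imfset.
- by apply/negP => /imfsetP[/= z zW /g_inj E]; rewrite -E (negPf vW) in zW.
- by rewrite nb_image in_imfset.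
Qed.

(** The formula uses the tree only through [nb] and the size of [W], and [g] carries both along. *)
Lemma tree_law_image (Q x : S -> R) (D c : R) W w :
  tree_law nb Q x D c [fset g v | v in W]%fset w =
  tree_law nb Q x D c W (w \o g).
Proof.
rewrite /tree_law card_imfset//=; congr (_ * _).
rewrite big_imfset /=; last by move=> ? ? _ _; exact: g_inj.
apply: eq_bigr => u _; rewrite nb_image big_imfset /=; last by move=> ? ? _ _; exact: g_inj.
by apply: eq_bigr => v _; rewrite /site_factor (mem_imfset _ _ g_inj).
Qed.
End Automorphism.

Section Invariance.
Context {R : realType} {d k : nat} {V : choiceType} {nb : V -> {fset V}}.
Hypothesis hV : is_cayley_tree d nb.
Local Notation S := 'rV[int]_k.
Implicit Types mu : probability (conf V k) R.

Lemma measurable_conf_map (f : conf V k -> conf V k) :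
    (forall y (B : set S), measurable [set s : conf V k | B (f s y)]) ->
  measurable_fun setT f.
Proof.
move=> mf; apply: (@measurability _ _ (conf V k) (conf V k) setT f (@cylinders V k) erefl).
by move=> _ [_ [y [B ->]] <-]; rewrite setTI; exact: mf.
Qed.

Lemma pushforward_cyl_eq mu1 mu2 (f : conf V k -> conf V k) :
    measurable_fun setT f ->
    (forall W, subtree nb W -> forall w, mu1 (f @^-1` cyl W w) = mu2 (cyl W w)) ->
  forall A, measurable A -> pushforward mu1 f A = mu2 A.
Proof.
move=> mf mu12 A mA.
have [e [idx [idxK eK enb]]] := tree_enumeration hV.
have sf : f \in mfun by rewrite inE; exact: mf.
apply: (conf_measure_ext idxK eK (N := 1%N) (m1 := distribution mu1 (mfun_Sub sf))
  (m2 := mu2)) => //.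
- by transitivity (1 : \bar R)%E; [|symmetry]; exact: probability_setT.
- apply: (@le_lt_trans _ _ 1%E); last exact: ltry.
  rewrite le_eqVlt; apply/orP; left; apply/eqP; exact: probability_setT.
- by move=> [//|n] w _; apply: mu12; exact: (subtree_prefix _ idxK eK enb).
Qed.

Variables (Q : S -> R).

Definition has_tree_law mu (x : S -> R) (D c : R) := forall W, subtree nb W ->
  forall w, mu (cyl W w) = (tree_law nb Q x D c W w)%:E.

Lemma tree_law_invariant mu x D c : has_tree_law mu x D c -> is_tree_invariant nb mu.
Proof.
move=> muE g [[h gK hK] g_adj] A mA.
apply: pushforward_cyl_eq => // [|W tW w].
  by apply: measurable_conf_map => y B; exact: (measurable_coord (g y) B).
rewrite (_ : _ @^-1` _ = cyl [fset g v | v in W]%fset (w \o h)).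
  rewrite !muE//; last exact: (subtree_image gK hK g_adj tW).
  rewrite (tree_law_image gK hK g_adj); congr (_%:E).
  by apply: eq_tree_law => y _ /=; rewrite gK.
apply/seteqP; split => s hs y.
  by move=> /imfsetP[/= z zW ->]; rewrite /= gK; exact: hs.
by move=> yW; have := hs (g y); rewrite /= gK; apply; exact: in_imfset.
Qed.

(** [Q] sees only differences of spins, and the shift of [x] absorbs the translation. *)
Lemma tree_law_translate mu1 mu2 (x : S -> R) D c (i j : S) :
    has_tree_law mu1 (fun a => x (a - i)) D c ->
    has_tree_law mu2 (fun a => x (a - j)) D c ->
  forall A, measurable A -> mu2 A = pushforward mu1 (@translate V k (j - i)) A.
Proof.
move=> mu1E mu2E A mA; symmetry; apply: pushforward_cyl_eq => // [|W tW w].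
  apply: measurable_conf_map => y B.
  exact: (measurable_coord y [set a | B (a + (j - i))]).
rewrite (_ : _ @^-1` _ = cyl W (fun y => w y - (j - i))).
  rewrite mu1E// mu2E//; congr (_%:E); congr (_ * _).
  apply: eq_bigr => u _; apply: eq_bigr => v _; rewrite /site_factor.
  case: ifP => _; last by congr x; rewrite opprB addrA addrAC addrK.
  by move: (j - i) => a; rewrite opprB addrA subrK.
by apply/seteqP; split => s hs y yW;
  [rewrite -(hs y yW) addrK|rewrite /translate hs// subrK].
Qed.
End Invariance.
Arguments has_tree_law {R k V} nb Q mu x D c.

(** * From norms to sums, and assembly *)

Lemma lpnorm_esum (R : realType) (T : choiceType) (r : R) (A : set T) (f : T -> R)
    (B : R) : 0 < r -> 0 <= B -> lpnorm r A f = B%:E ->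
  (\esum_(j in A) (`|f j| `^ r)%:E)%E = (B `^ r)%:E.
Proof.
move=> r0 B0; rewrite /lpnorm; set E := esum _ _.
have : (0 <= E)%E by apply: esum_ge0 => i _; rewrite lee_fin powR_ge0.
(* An infinite sum would have an infinite root, contrary to the value [B%:E]. *)
case: E => [y|_|//]; last by rewrite poweRyr// invr_eq0 gt_eqF.
rewrite lee_fin => y0 [<-].
by rewrite -powRrM mulVf ?gt_eqF// powRr1.
Qed.

Lemma sqrt_expr_powR (R : realType) (a : R) n : 0 <= a ->
  Num.sqrt a ^+ n = a `^ (n%:R / 2).
Proof.
by move=> a0; rewrite -powR12_sqrt// -powR_mulrn ?powR_ge0// -powRrM mulrC.
Qed.

Lemma tree_gibbs_measure (R : realType) (d k : nat) (V : choiceType)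
    (nb : V -> {fset V}) (hV : is_cayley_tree d nb) (Q x : 'rV[int]_k -> R) (D X : R) :
    (forall i, 0 < Q i) -> (forall i, Q (- i) = Q i) -> (forall i, 0 < x i) -> 0 < D ->
    0 < 1 + X ->
    (forall i, (\esum_(j in setT) (Q (i - j) * x j ^+ d)%:E)%E = (D * x i)%:E) ->
    (\esum_(j in setT) (x j ^+ d.+1)%:E)%E = (1 + X)%:E ->
  exists mu : probability (conf V k) R,
    [/\ has_tree_law nb Q mu x D (1 + X)^-1, is_gibbs nb Q mu
      & is_tree_invariant nb mu].
Proof.
move=> Qpos Qeven xpos D0 X0 xlaw xnorm.
have c0 : 0 < (1 + X)^-1 by rewrite invr_gt0.
have [|mu muE] := tree_measure_exists hV Qpos Qeven xpos D0 c0 xlaw.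
  by rewrite invrK.
exists mu; split=> //; last exact: (tree_law_invariant hV muE).
move=> Lam A mA.
have [e [idx [idxK eK enb]]] := tree_enumeration hV.
exact: (gibbs_spec hV Qpos Qeven xpos D0 c0 muE idxK eK enb).
Qed.

Theorem theorem1 (R : realType) (d k : nat) (hd : (2 <= d)%N) (hk : (1 <= k)%N)
    (V : choiceType) (nb : V -> {fset V}) (hV : is_cayley_tree d nb)
    (Q : 'rV[int]_k -> R)
    (Qpos : forall i : 'rV[int]_k, 0 < Q i)
    (Qeven : forall i : 'rV[int]_k, Q (- i) = Q i)
    (Q0 : Q 0 = 1)
    (gamma delta : R)
    (hgamma : lpnorm (d.+1%:R / 2) [set: 'rV[int]_k] Q = gamma%:E)
    (hdelta : lpnorm d.+1%:R [set i : 'rV[int]_k | i <> 0] Q = delta%:E)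
    (hgood : good_set d (gamma, delta)) :
  exists eps : R, is_smallest_positive_solution d gamma delta eps /\
  exists mu : 'rV[int]_k -> probability (conf V k) R,
    [/\ forall i j : 'rV[int]_k, i <> j ->
          exists2 A : set (conf V k), measurable A & mu i A <> mu j A,
        forall i : 'rV[int]_k, is_gibbs nb Q (mu i),
        forall i : 'rV[int]_k, is_tree_invariant nb (mu i),
        forall (i j : 'rV[int]_k) (A : set (conf V k)), measurable A ->
          mu j A = pushforward (mu i) (@translate V k (j - i)) A &
        forall (i : 'rV[int]_k) (o : V),
          let ratio := fine (mu i [set s : conf V k | s o <> i]) /
                       fine (mu i [set s : conf V k | s o = i]) in
          (delta * ((1 - delta * eps ^+ d) / (1 + gamma * eps ^+ d.-1))) ^+ d.+1
            <= ratio <=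
          (delta * ((1 + delta * eps ^+ d) / (1 - gamma * eps ^+ d.-1))) ^+ d.+1].
Proof.
case: d hd hV hgamma hdelta hgood => [|[|p]] // _ hV hgamma hdelta.
move=> [/= gamma1 delta0 [e0 [e0_gt0 e0T e0theta]]].
have gamma0 : 0 < gamma := lt_trans ltr01 gamma1.
have [eps epsP eps_le] := smallest_solution (ltW gamma0) delta0 e0_gt0 e0T.
have [eps0 epsE _] := epsP.
have eps_pow n : eps ^+ n <= e0 ^+ n by rewrite lerXn2r// nnegrE ltW.
(* The good set gives this at its witness [e0]; both terms increase with the radius, and
   [eps <= e0]. *)
have theta1 : 2 * p.+2%:R * gamma * eps ^+ p.+1 + 2 * p.+2%:R * delta * eps ^+ p.+2 < 1.
  apply: le_lt_trans e0theta; apply: lerD; apply: ler_wpM2l => //.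
    by rewrite !mulr_ge0// ltW.
  by rewrite !mulr_ge0// ltW.
have Qnorm i : `|Q i| = Q i by rewrite gtr0_norm.
have Qgamma : sum_le (fun i => Num.sqrt (Q i) ^+ p.+3) (Num.sqrt gamma ^+ p.+3).
  have := lpnorm_esum _ (ltW gamma0) hgamma; rewrite /sum_le sqrt_expr_powR ?(ltW gamma0)//.
  move=> <-; last by rewrite divr_gt0.
  by apply: le_esum => i _; rewrite sqrt_expr_powR ?Qnorm// ltW.
have Qdelta : (\esum_(i in setT) (((if i == 0 then 0 else Q i) : R) ^+ p.+3)%:E)%E =
    (delta ^+ p.+3)%:E.
  have := lpnorm_esum _ (ltW delta0) hdelta.
  rewrite powR_mulrn ?(ltW delta0)// => <-//; rewrite [RHS]esum_mkcond.
  apply: eq_esum => i _; case: eqVneq => [->|i0].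
    by rewrite memNset ?expr0n//=; apply.
  by rewrite mem_set; [rewrite Qnorm powR_mulrn// ltW|exact/eqP].
have epsT : delta + gamma * eps ^+ p.+2 <= eps by rewrite addrC -epsE.
have Qdelta_le : sum_le (fun i => (if i == 0 then 0 else Q i) ^+ p.+3) (delta ^+ p.+3).
  by rewrite /sum_le Qdelta.
have Qdelta_ge B : 0 <= B ->
    sum_le (fun i => (if i == 0 then 0 else Q i) ^+ p.+3) (B ^+ p.+3) -> delta <= B.
  move=> B0; rewrite /sum_le Qdelta lee_fin.
  by rewrite ler_pXn2r// nnegrE ltW.
have [x [D [X [[x0 D0 xpos] [x_lt1 xlaw xnorm Xbounds]]]]] :=
  boundary_law_exists Qpos Qeven Q0 (ltW gamma1) (ltW delta0) eps0 Qgamma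
    Qdelta_le Qdelta_ge epsT theta1.
exists eps; split=> //.
have x1_le : 1 <= 1 + X.
  have := @sum_le_term _ _ (fun j => x j ^+ p.+3) (1 + X).
  rewrite /sum_le xnorm lexx => /(_ _ isT 0); rewrite x0 expr1n; apply.
  by move=> i; rewrite exprn_ge0// ltW.
have X1 : 0 < 1 + X := lt_le_trans ltr01 x1_le.
pose c := (1 + X)^-1.
have c0 : 0 < c by rewrite invr_gt0.
have esum_shift (f : 'rV[int]_k -> \bar R) i :
    \esum_(j in setT) f (j - i) = \esum_(j in setT) f j.
  symmetry; apply: (reindex_esum setT setT (fun j => j - i)).
  split=> //= [a b _ _ /addIr//|b _]; by exists (b + i) => //; rewrite addrK.
have ex_mu i : exists mu : probability (conf V k) R,
    [/\ has_tree_law nb Q mu (fun a => x (a - i)) D c, is_gibbs nb Q mu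
      & is_tree_invariant nb mu].
  apply: (tree_gibbs_measure hV) => // [a|].
    rewrite -xlaw -[RHS](esum_shift _ i); apply: eq_esum => j _.
    by rewrite opprB addrA subrK.
  by rewrite -xnorm -[RHS](esum_shift _ i).
have [mu muP] := choice ex_mu.
have mu_site i j (o : V) :
    mu i [set s : conf V k | s o = j] = (c * x (j - i) ^+ p.+3)%:E.
  have [muE _ _] := muP i.
  have := muE _ (subtree1 o) (fun=> j); rewrite (tree_law1 hV)// => <-.
  congr (mu i _); apply/seteqP; split => s /= hs.
    by move=> y; rewrite inE => /eqP ->.
  by apply: hs; rewrite inE.
exists mu; split.
- move=> i j ij.
  have [r _] : [set: V] !=set0.
    by apply/set0P/negP => /eqP E; have := cayley_infinite hV; rewrite E.
  exists [set s : conf V k | s r = i].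
    exact: (measurable_coord r [set a | a = i]).
  rewrite !mu_site subrr x0 expr1n mulr1 => -[cE].
  (* Equality of the two marginals at spin [i] would force this power to be [1]. *)
  have : x (i - j) ^+ p.+3 < 1.
    by rewrite exprn_ilt1// ?x_lt1 ?subr_eq0 ?ltW//; exact/eqP.
  by rewrite -(ltr_pM2l c0) mulr1 -cE ltxx.
- by move=> i; have [] := muP i.
- by move=> i; have [] := muP i.
- move=> i j A mA; have [mui _ _] := muP i; have [muj _ _] := muP j.
  exact: (tree_law_translate hV mui muj).
- move=> i r; have mi : measurable [set s : conf V k | s r = i].
    exact: (measurable_coord r [set a | a = i]).
  have -> : [set s : conf V k | s r <> i] = ~` [set s : conf V k | s r = i] by [].
  rewrite /= probability_setC// mu_site subrr x0 expr1n mulr1 -EFinB /=.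
  (* The site takes the value [i] with probability [c = (1 + X)^-1], so the ratio is [X] itself. *)
  by rewrite (_ : (1 - c) / c = X)// /c; field; rewrite gt_eqF.
Qed.
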